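(* Let $X$ be a complex manifold of complex dimension $n$ and let $q\in\{1,\ldots,n\}$. If $X$ is cohomologically $q$-complete, then $X$ is cohomologically Bott-Chern $q$-complete.
   Context: $\mathbb{N}$ includes $0$. For a complex manifold $X$, $\wedge^{r,s}X$ denotes the space of smooth complex-valued $(r,s)$-forms on $X$, with $\wedge^{r,s}X=\{0\}$ if $r\notin\mathbb{N}$ or $s\notin\mathbb{N}$. $H^{r,s}_{\overline{\partial}}(X)$ denotes Dolbeault cohomology. The Bott-Chern cohomology is $H^{\bullet,\bullet}_{BC}(X)=\dfrac{\ker\partial\cap\ker\overline{\partial}}{\operatorname{im}\partial\overline{\partial}}$, that is, $H^{r,s}_{BC}(X)=\dfrac{\{\alpha\in\wedge^{r,s}X:\partial\alpha=0=\overline{\partial}\alpha\}}{\partial\overline{\partial}(\wedge^{r-1,s-1}X)}$. For $q\in\mathbb{N}\setminus\{0\}$, a complex manifold $X$ is called cohomologically $q$-complete if $H^{r,s}_{\overline{\partial}}(X)=\{0\}$ for any $r\in\mathbb{N}$ and any $s\geq q$. For a complex manifold $X$ of complex dimension $n$ and an integer $q\in\{1,\ldots,n\}$, $X$ is called cohomologically Bott-Chern $q$-complete if $H^{r,s}_{BC}(X)=\{0\}$ for any positive integers $r$ and $s$ such that $r+s\geq n+q$. *)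

(* Defs.v *)
From HB Require Import structures.
From mathcomp Require Import all_boot all_order all_algebra complex.
From mathcomp Require Import all_classical all_reals all_analysis.

Set Implicit Arguments.
Unset Strict Implicit.
Unset Printing Implicit Defensive.

Import Order.TTheory GRing.Theory Num.Theory.
Import numFieldNormedType.Exports.

Local Open Scope classical_set_scope.
Local Open Scope complex_scope.
Local Open Scope ring_scope.

(* Declaring R[i] as a numClosedFieldType gives it, and the matrices over it,
   the topology of the modulus. *)
Definition Cx (R : realType) : numClosedFieldType := R[i].

Section Calculus.
Variables (R : realType) (n : nat).
Local Notation C := (Cx R).
Local Notation Cn := 'rV[C]_n.
Implicit Types (f : Cn -> C) (v z : Cn) (U : set Cn).

Definition re_along f v z (t : R) : R := complex.Re (f (z + (t%:C : C) *: v)).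
Definition im_along f v z (t : R) : R := complex.Im (f (z + (t%:C : C) *: v)).

(* Derivative of f at z along v, for the underlying real vector space. *)
Definition rderivable f v z : Prop :=
  derivable (re_along f v z) 0 1 /\ derivable (im_along f v z) 0 1.
Definition rderive f v z : C :=
  (derive1 (re_along f v z) 0) +i* (derive1 (im_along f v z) 0).

Fixpoint Ck_on (k : nat) U f : Prop :=
  (forall z, U z -> {for z, continuous f}) /\
  (if k is k'.+1 then
     forall v, (forall z, U z -> rderivable f v z) /\ Ck_on k' U (rderive f v)
   else True).

Definition smooth_on U f : Prop := forall k, Ck_on k U f.

(* Wirtinger derivatives along v = (v_1, ..., v_n):
   wirt f v = \sum_j v_j * df/dz_j   and
   wirtbar f v = \sum_j (v_j)^* * df/d(z_j)^*. *)
Definition wirt f v z : C :=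
  (rderive f v z - 'i%C * rderive f (('i%C : C) *: v) z) / 2%:R.
Definition wirtbar f v z : C :=
  (rderive f v z + 'i%C * rderive f (('i%C : C) *: v) z) / 2%:R.

(* Smooth solutions of the Cauchy-Riemann equations. *)
Definition holomorphic_on m U (F : Cn -> 'rV[C]_m) : Prop :=
  forall j, smooth_on U (fun w => F w 0 j) /\
    forall z, U z -> forall v, wirtbar (fun w => F w 0 j) v z = 0.

(* Complex Jacobian matrix, acting on row vectors on the right. *)
Definition jacobianC m (F : Cn -> 'rV[C]_m) z : 'M[C]_(n, m) :=
  \matrix_(i, j) wirt (fun w => F w 0 j) (delta_mx 0 i) z.

(* Alternating maps in the k rows of a matrix, each row being linear up to the
   twist sigma of the scalars (the identity or the complex conjugation). *)
Definition semi_multilinear (sigma : C -> C) k (F : 'M[C]_(k, n) -> C) : Prop :=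
  forall (i : 'I_k) (A A1 A2 : 'M[C]_(k, n)) (c : C),
    row i A = c *: row i A1 + row i A2 ->
    row' i A = row' i A1 -> row' i A = row' i A2 ->
    F A = sigma c * F A1 + F A2.

Definition alternating k (F : 'M[C]_(k, n) -> C) : Prop :=
  forall (i j : 'I_k) (A : 'M[C]_(k, n)),
    i != j -> row i A = row j A -> F A = 0.

End Calculus.

Record chart (R : realType) (n : nat) (X : topologicalType) := Chart {
  chart_dom : set X;
  chart_img : set 'rV[Cx R]_n;
  chart_map : X -> 'rV[Cx R]_n;
  chart_inv : 'rV[Cx R]_n -> X;
  chart_dom_open : open chart_dom;
  chart_img_open : open chart_img;
  chart_map_in : forall x, chart_dom x -> chart_img (chart_map x);
  chart_inv_in : forall z, chart_img z -> chart_dom (chart_inv z);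
  chart_mapK : forall x, chart_dom x -> chart_inv (chart_map x) = x;
  chart_invK : forall z, chart_img z -> chart_map (chart_inv z) = z;
  chart_map_cont : {within chart_dom, continuous chart_map};
  chart_inv_cont : {within chart_img, continuous chart_inv}
}.

Definition overlap (R : realType) n (X : topologicalType) (a b : chart R n X) :
    set 'rV[Cx R]_n :=
  [set z | chart_img a z /\ chart_dom b (chart_inv a z)].

Definition transition (R : realType) n (X : topologicalType)
    (a b : chart R n X) (z : 'rV[Cx R]_n) : 'rV[Cx R]_n :=
  chart_map b (chart_inv a z).

(* The complex structure is given by an atlas, which need not be maximal. *)
Record complex_manifold (R : realType) (n : nat) := ComplexManifold {
  cm_space :> topologicalType;
  cm_hausdorff : hausdorff_space cm_space;
  cm_second_countable : @second_countable cm_space;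
  cm_index : Type;
  cm_chart : cm_index -> chart R n cm_space;
  cm_cover : forall x : cm_space, exists a, chart_dom (cm_chart a) x;
  cm_holomorphic : forall a b,
    holomorphic_on (overlap (cm_chart a) (cm_chart b))
                   (transition (cm_chart a) (cm_chart b))
}.

Section Forms.
Variables (R : realType) (n : nat) (X : complex_manifold R n).
Local Notation C := (Cx R).
Local Notation Cn := 'rV[C]_n.

(* An (r,s)-form is given by its expressions in the charts of the atlas. In a
   chart, the form  \sum_(I, J) w_IJ dz_I /\ d(z_J)^*  is represented at z by
   its values on r vectors of type (1,0) and s vectors of type (0,1), namely
   the  \sum_k u_k d/dz_k  for u a row of A and the
   \sum_k (v_k)^* d/d(z_k)^*  for v a row of B; thus
   w_IJ(z) = w a z (e_I) (e_J).  The values of w a outside of the image of the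
   chart a are meaningless. *)
Definition local_forms (r s : nat) : Type :=
  cm_index X -> Cn -> 'M[C]_(r, n) -> 'M[C]_(s, n) -> C.

Definition eq_forms r s (w1 w2 : local_forms r s) : Prop :=
  forall a z, chart_img (cm_chart a) z -> forall A B, w1 a z A B = w2 a z A B.

Definition forms (r s : nat) : set (local_forms r s) := [set w |
  [/\ forall a z, chart_img (cm_chart a) z ->
        (forall B, semi_multilinear id (fun A => w a z A B) /\
                   alternating (fun A => w a z A B)) /\
        (forall A, semi_multilinear (fun c : C => Num.conj c) (w a z A) /\
                   alternating (w a z A)),
      forall a A B,
        smooth_on (chart_img (cm_chart a)) (fun z => w a z A B)
    & forall a b z, overlap (cm_chart a) (cm_chart b) z -> forall A B,
        let t := transition (cm_chart a) (cm_chart b) in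
        let J := jacobianC t z in
        w a z A B = w b (t z) (A *m J) (B *m J)]].

(* Components of the exterior derivative: the exterior derivative of w takes
   the value  \sum_i (-1)^i x_i . w(x_0, .., omit x_i, .., x_(r+s))  on constant
   vector fields, the r vectors of type (1,0) being placed first; this is the
   origin of the sign (-1)^r. *)
Definition del r s (w : local_forms r s) : local_forms r.+1 s :=
  fun a z A B => \sum_(i < r.+1)
    (-1) ^+ i * wirt (fun x => w a x (row' i A) B) (row i A) z.

Definition delbar r s (w : local_forms r s) : local_forms r s.+1 :=
  fun a z A B => (-1) ^+ r * \sum_(j < s.+1)
    (-1) ^+ j * wirtbar (fun x => w a x A (row' j B)) (row j B) z.

(* Z / B, as the set of the classes modulo B of the elements of Z. *)
Definition coset_mod r s (Z B : set (local_forms r s)) (w : local_forms r s) :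
    set (local_forms r s) :=
  [set w' | Z w' /\ B (fun a z U V => w' a z U V - w a z U V)].
Definition cohomology_of r s (Z B : set (local_forms r s)) :
    set (set (local_forms r s)) :=
  [set coset_mod Z B w | w in Z].

Definition zero_form r s : local_forms r s := fun _ _ _ _ => 0.
Arguments zero_form {r s}.

Definition dolbeault_cocycles r s : set (local_forms r s) :=
  [set w | forms w /\ eq_forms (delbar w) zero_form].
Arguments dolbeault_cocycles : clear implicits.

(* There are no nonzero (r,-1)-forms. *)
Definition dolbeault_coboundaries r s : set (local_forms r s) :=
  match s return set (local_forms r s) with
  | 0%N => [set w | eq_forms w zero_form]
  | s'.+1 => [set w | exists2 e : local_forms r s',
                        forms e & eq_forms w (delbar e)]
  end.
Arguments dolbeault_coboundaries : clear implicits.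

Definition dolbeault_cohomology r s : set (set (local_forms r s)) :=
  cohomology_of (dolbeault_cocycles r s) (dolbeault_coboundaries r s).
Arguments dolbeault_cohomology : clear implicits.

Definition dolbeault_zero r s : set (local_forms r s) :=
  coset_mod (dolbeault_cocycles r s) (dolbeault_coboundaries r s) zero_form.
Arguments dolbeault_zero : clear implicits.

Definition bott_chern_cocycles r s : set (local_forms r s) :=
  [set w | [/\ forms w, eq_forms (del w) zero_form
             & eq_forms (delbar w) zero_form]].
Arguments bott_chern_cocycles : clear implicits.

Definition bott_chern_coboundaries r s : set (local_forms r s) :=
  match r, s return set (local_forms r s) with
  | r'.+1, s'.+1 => [set w | exists2 e : local_forms r' s',
                               forms e & eq_forms w (del (delbar e))]
  | _, _ => [set w | eq_forms w zero_form]
  end.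
Arguments bott_chern_coboundaries : clear implicits.

Definition bott_chern_cohomology r s : set (set (local_forms r s)) :=
  cohomology_of (bott_chern_cocycles r s) (bott_chern_coboundaries r s).
Arguments bott_chern_cohomology : clear implicits.

Definition bott_chern_zero r s : set (local_forms r s) :=
  coset_mod (bott_chern_cocycles r s) (bott_chern_coboundaries r s) zero_form.
Arguments bott_chern_zero : clear implicits.

Definition cohomologically_complete (q : nat) : Prop :=
  forall r s : nat, (q <= s)%N ->
    dolbeault_cohomology r s = [set dolbeault_zero r s].

Definition cohomologically_bott_chern_complete (q : nat) : Prop :=
  forall r s : nat, (0 < r)%N -> (0 < s)%N -> (n + q <= r + s)%N ->
    bott_chern_cohomology r s = [set bott_chern_zero r s].

End Forms.

(* Main.v *)
Require Import Defs.
From mathcomp Require Import all_boot all_order all_algebra complex.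
From mathcomp Require Import all_classical all_reals all_analysis.
From mathcomp Require Import perm ring lra zify.

Set Implicit Arguments.
Unset Strict Implicit.
Unset Printing Implicit Defensive.

Import Order.TTheory GRing.Theory Num.Theory.
Import numFieldNormedType.Exports.

Local Open Scope classical_set_scope.
Local Open Scope complex_scope.
Local Open Scope ring_scope.

(* Let w be a d- and dbar-closed (r,s)-form with r, s >= 1 and r + s >= n + q.
   If r > n or s > n then w = 0. Otherwise r, s >= q, so that w = dbar b. Then
   d b is a d- and dbar-closed (r+1,s-1)-form of the same total degree; by
   descending induction on r it is zero or equals d (dbar g), and replacing b by
   b - dbar g one may assume that d b = 0. As r >= q, the conjugate of the
   vanishing of Dolbeault cohomology gives b = d e, and w = dbar (d e) =
   - d (dbar e).
     With forms given by their chart expressions, the work lies in the calculus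
   behind this: d preserves forms (the second derivatives of a change of charts
   are symmetric, and cancel by alternation), d d = 0 and d dbar = - dbar d
   (symmetry of second derivatives), and dbar is conjugate to d up to sign. *)

(** * Directional derivatives of real functions on C^n *)

Section RealCalculus.
Variables (R : realType) (n : nat).
Local Notation C := (Cx R).
Local Notation Cn := 'rV[C]_n.

(** The degree bound serves twice. With r, s <= n it gives both r >= q and s >= q, so that the
    vanishing theorem applies to w and, after conjugation, to b. It also keeps the induction inside
    positive degrees: if s = 1 then r >= n, so d b has more than n arguments of type (1,0) and
    vanishes, and the induction hypothesis is called only when s - 1 >= 1. Smoothness is defined by
    iterating directional derivatives along fixed real directions, which does not by itself express
    how they depend on the direction. Linearity in the direction, the chain rule and the symmetry of
    second derivatives are all drawn from the continuity of these derivatives through the mean value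
    theorem. A change of charts multiplies the arguments of a form by a Jacobian that varies with
    the point, so d of a pullback requires a product rule for multilinear maps whose arguments
    move. *)

Lemma cvg_Re (T : Type) (F : set_system T) (FF : Filter F) (f : T -> C) (l : C) :
  f x @[x --> F] --> l -> complex.Re (f x) @[x --> F] --> complex.Re l.
Proof.
move=> /cvgrPdist_lt fl; apply/cvgrPdist_lt => e e0.
have /fl : 0 < (e%:C : C) by rewrite ltcR.
apply: filterS => x; rewrite -ltcR; apply: le_lt_trans.
by rewrite -raddfB; exact: normc_ge_Re.
Qed.

Lemma cvg_Im (T : Type) (F : set_system T) (FF : Filter F) (f : T -> C) (l : C) :
  f x @[x --> F] --> l -> complex.Im (f x) @[x --> F] --> complex.Im l.
Proof.
move=> /cvgrPdist_lt fl; apply/cvgrPdist_lt => e e0.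
have /fl : 0 < (e%:C : C) by rewrite ltcR.
apply: filterS => x; rewrite -ltcR; apply: le_lt_trans.
rewrite -raddfB; case: (l - f x) => a b /=.
rewrite normc_def /= lecR -sqrtr_sqr ler_sqrt ?addr_ge0 ?sqr_ge0 //.
by rewrite lerDr sqr_ge0.
Qed.

Lemma cvg_realC (T : Type) (F : set_system T) (FF : Filter F) (f : T -> R) (l : R) :
  f x @[x --> F] --> l -> ((f x)%:C : C) @[x --> F] --> (l%:C : C).
Proof.
move=> /cvgrPdist_lt fl; apply/cvgrPdist_lt => e e0.
have eE : e = (complex.Re e)%:C.
  by case: e e0 => a b; rewrite ltcE /= => /andP[/eqP ->].
have /fl : 0 < complex.Re e by rewrite -ltcR -eE.
by apply: filterS => x; rewrite -rmorphB /= normc_def /= expr0n addr0 sqrtr_sqr eE ltcR.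
Qed.

Lemma cvg_along (T : Type) (F : set_system T) (FF : Filter F) (p : T -> Cn)
    (c : T -> R) (z v : Cn) (l : R) :
  p x @[x --> F] --> z -> c x @[x --> F] --> l ->
  (p x + ((c x)%:C : C) *: v) @[x --> F] --> z + (l%:C : C) *: v.
Proof.
move=> pz cl; 
have h := @cvgZr_tmp C Cn T F FF _ _ v (cvg_realC FF cl).
exact: (@cvgD C Cn T F FF _ _ _ _ pz h).
Qed.

Definition has_der (f : R -> R) (a d : R) : Prop := is_derive a (1 : R) f d.

Lemma has_der_unique (f : R -> R) (a d : R) : has_der f a d -> derive1 f a = d.
Proof. by case=> _ <-; rewrite derive1E. Qed.

Lemma has_der_derive1 (f : R -> R) (a : R) : derivable f a 1 -> has_der f a (derive1 f a).
Proof. by move=> h; rewrite derive1E; exact: derivableP. Qed.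

Lemma has_derD (f g : R -> R) (a df dg : R) :
  has_der f a df -> has_der g a dg -> has_der (fun t => f t + g t) a (df + dg).
Proof. exact: is_deriveD. Qed.

Lemma has_derN (f : R -> R) (a df : R) :
  has_der f a df -> has_der (fun t => - f t) a (- df).
Proof. exact: is_deriveN. Qed.

Lemma has_derB (f g : R -> R) (a df dg : R) :
  has_der f a df -> has_der g a dg -> has_der (fun t => f t - g t) a (df - dg).
Proof. exact: is_deriveB. Qed.

Lemma has_derM (f g : R -> R) (a df dg : R) :
  has_der f a df -> has_der g a dg ->
  has_der (fun t => f t * g t) a (f a * dg + g a * df).
Proof. exact: is_deriveM. Qed.

Lemma has_der_cst (k a : R) : has_der (fun=> k) a 0.
Proof. exact: is_derive_cst. Qed.

Lemma has_der_id (a : R) : has_der id a 1.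
Proof. exact: is_derive_id. Qed.

Lemma has_derZ (k : R) (f : R -> R) (a df : R) :
  has_der f a df -> has_der (fun t => k * f t) a (k * df).
Proof.
by move=> h; have := has_derM (has_der_cst k a) h; rewrite mulr0 addr0.
Qed.

Lemma has_der_shift (f : R -> R) (a d : R) :
  has_der (fun t => f (a + t)) 0 d -> has_der f a d.
Proof.
move=> /is_derive1_caratheodory[g [gE gc g0]].
apply/is_derive1_caratheodory; exists (fun t => g (t - a)); split.
- by move=> t; have := gE (t - a); rewrite addr0 subr0 subrKC.
- have tc : t - a @[t --> a] --> (0 : R).
    by rewrite -[X in _ --> X](subrr a); apply: cvgB; [exact: cvg_id|exact: cvg_cst].
  suff : g (t - a) @[t --> a] --> g (a - a) by [].
  by rewrite subrr; exact: (cvg_comp _ _ tc gc).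
- by rewrite subrr.
Qed.

(** A form of the mean value theorem that treats both signs of [c] at once and stays true for
    [c = 0], where no quotient could be formed. *)
Lemma mean_value0 (f df : R -> R) (c : R) :
  (forall t, `|t| <= `|c| -> has_der f t (df t)) ->
  exists2 t, `|t| <= `|c| & f c - f 0 = df t * c.
Proof.
move=> fd.
have fc (a b : R) : (forall t, a <= t <= b -> `|t| <= `|c|) ->
    {within `[a, b], continuous f}.
  move=> ab; apply: derivable_within_continuous => t; rewrite in_itv /= => /ab /fd.
  by case.
case: (leP 0 c) => c0.
  have h t : 0 <= t <= c -> `|t| <= `|c|.
    by case/andP=> t0 tc; rewrite !ger0_norm // (le_trans t0).
  have [t||t] := @MVT_segment R f df 0 c c0.
  - by rewrite in_itv /= => /andP[/ltW t0 /ltW tc]; apply/fd/h/andP.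
  - exact: fc.
  - by rewrite in_itv /= => /h tc; rewrite subr0; exists t.
have h t : c <= t <= 0 -> `|t| <= `|c|.
  by case/andP=> tc t0; rewrite !ler0_norm ?lerN2 // ltW.
have [t||t] := @MVT_segment R f df c 0 (ltW c0).
- by rewrite in_itv /= => /andP[/ltW t0 /ltW tc]; apply/fd/h/andP.
- exact: fc.
- rewrite in_itv /= => /h tc E; exists t => //.
  by rewrite -opprB E sub0r mulrN opprK.
Qed.

Definition along (g : Cn -> R) (v z : Cn) (t : R) : R := g (z + (t%:C : C) *: v).

Definition dirder (g : Cn -> R) (v z : Cn) : R := derive1 (along g v z) 0.

Definition dirdiff (g : Cn -> R) (v z : Cn) : Prop := derivable (along g v z) 0 1.

Lemma dirdiffP (g : Cn -> R) (v z : Cn) :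
  dirdiff g v z -> has_der (along g v z) 0 (dirder g v z).
Proof. exact: has_der_derive1. Qed.

Lemma realCD (a b : R) : ((a + b)%:C : C) = (a%:C : C) + (b%:C : C).
Proof. exact: (raddfD (real_complex R)). Qed.

Lemma realCM (a b : R) : ((a * b)%:C : C) = (a%:C : C) * (b%:C : C).
Proof. exact: (rmorphM (real_complex R)). Qed.

Lemma alongD (z v : Cn) (s t : R) :
  z + (s%:C : C) *: v + (t%:C : C) *: v = z + ((s + t)%:C : C) *: v.
Proof. by rewrite realCD scalerDl addrA. Qed.

(** Rebasing the line at its point of parameter [t] turns a derivative at [t] into one at 0, the
    only parameter at which [dirder] is defined. *)
Lemma has_der_along (g : Cn -> R) (v z : Cn) (t : R) :
  dirdiff g v (z + (t%:C : C) *: v) ->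
  has_der (along g v z) t (dirder g v (z + (t%:C : C) *: v)).
Proof.
move=> /dirdiffP h.
apply: (@has_der_shift (along g v z) t).
have -> : (fun s => along g v z (t + s)) = along g v (z + (t%:C : C) *: v).
  by apply/funext => s; rewrite /along alongD.
exact: h.
Qed.

Lemma mean_value_along (g : Cn -> R) (v z : Cn) (c : R) :
  (forall t : R, `|t| <= `|c| -> dirdiff g v (z + (t%:C : C) *: v)) ->
  exists2 t : R, `|t| <= `|c| &
    g (z + (c%:C : C) *: v) - g z = dirder g v (z + (t%:C : C) *: v) * c.
Proof.
move=> h; have [t tc E] := @mean_value0 (along g v z) _ c
  (fun t tc => has_der_along (h t tc)).
by exists t => //; rewrite -E /along scale0r addr0.
Qed.

(** Continuity of (y, t) |-> y + t v at (z, 0). The length [e] is uniform in the base point, which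
    lets that point move in the sequel. *)
Lemma nbhs_segment (z v : Cn) (W : set Cn) : nbhs z W ->
  exists2 e : R, 0 < e &
    nbhs z [set y | forall t : R, `|t| < e -> W (y + (t%:C : C) *: v)].
Proof.
move=> Wz; have : \forall x \near ((z, 0) : Cn * R), W (x.1 + (x.2%:C : C) *: v).
  have := @cvg_along _ (nbhs ((z, 0) : Cn * R)) _ fst snd z v 0 cvg_fst cvg_snd.
  by rewrite scale0r addr0; apply.
case=> -[/= A B] [Az /nbhs_ballP[e /= e0 eB]] AB.
exists e => //; apply: (@filterS _ _ (nbhs_filter z) _ _ _ Az) => y Ay t te.
by apply: (AB (y, t)); split => //=; apply: eB; rewrite /ball /= sub0r normrN.
Qed.

Lemma near_segment (p : R -> Cn) (c : R -> R) (z v : Cn) (W : set Cn) :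
  {for 0, continuous p} -> p 0 = z -> {for 0, continuous c} -> c 0 = 0 ->
  nbhs z W ->
  \forall s \near (0 : R), forall t : R, `|t| <= `|c s| -> W (p s + (t%:C : C) *: v).
Proof.
move=> pc p0 cc c0 /(nbhs_segment v)[e e0 Wz].
have pW : \forall s \near (0 : R), forall t : R, `|t| < e -> W (p s + (t%:C : C) *: v).
  by rewrite -p0 in Wz; exact: (pc _ Wz).
have cB : \forall s \near (0 : R), `|c s| < e.
  move/cvgrPdist_lt : cc => /(_ e e0); apply: filterS => s.
  by rewrite c0 sub0r normrN.
near=> s => t tc.
have pWs : forall t : R, `|t| < e -> W (p s + (t%:C : C) *: v) by near: s.
by apply/pWs/(le_lt_trans tc); near: s.
Unshelve. all: by end_near.
Qed.

Lemma has_der_cont (f : R -> R) (x d : R) :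
  has_der f x d -> {for x, continuous f}.
Proof. by case=> /derivable1_diffP/differentiable_continuous. Qed.

(** The base point [p s] is only assumed continuous. By the mean value theorem the increment is
    [c s] times a derivative of g along v at a point that tends to z with s, and continuity of that
    derivative gives the limit. *)
Lemma has_der_increment (U : set Cn) (g : Cn -> R) (p : R -> Cn) (c : R -> R)
    (z v : Cn) (dc : R) :
  nbhs z U -> (forall y, U y -> dirdiff g v y) ->
  {for z, continuous (dirder g v)} ->
  {for 0, continuous p} -> p 0 = z -> c 0 = 0 -> has_der c 0 dc ->
  has_der (fun s => g (p s + ((c s)%:C : C) *: v) - g (p s)) 0
    (dc * dirder g v z).
Proof.
move=> zU gU gc pc p0 c0 cd; have cc := has_der_cont cd.
move: cd => /is_derive1_caratheodory[k [kE kc <-]].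
set D := dirder g v z.
pose h s := g (p s + ((c s)%:C : C) *: v) - g (p s).
(* [r] is the difference quotient of g along v. Since [c] may vanish arbitrarily close to 0, the
   limit [D] is taken as its value there, which keeps [r] continuous at 0. *)
pose r s := if c s == 0 then D else h s / c s.
apply/is_derive1_caratheodory; exists (fun s => k s * r s); split.
- move=> s; rewrite subr0 c0 scale0r addr0 subrr subr0 -/(h s).
  have := kE s; rewrite c0 !subr0 mulrAC => <-; rewrite /r.
  case: eqP => [cs|/eqP cs]; last by rewrite mulrC divfK.
  by rewrite /h cs scale0r addr0 subrr mul0r.
- apply: cvgM => //; rewrite /r c0 eqxx.
  apply/cvgrPdist_lt => e e0.
  have W : nbhs z [set y | U y /\ `|D - dirder g v y| < e].
    by apply: filterI => //; move/cvgrPdist_lt : gc; apply.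
  have := near_segment v pc p0 cc c0 W; apply: filterS => s Ws.
  case: eqP => [_|/eqP cs]; first by rewrite subrr normr0.
  have [t /Ws[_ te] E] := @mean_value_along g v (p s) (c s) (fun t tc => gU _ (Ws t tc).1).
  by rewrite /h E mulfK.
- by rewrite /r c0 eqxx.
Qed.

(** The directions are added one at a time: each contributes an increment from a base point that is
    already moving, and these increments telescope. *)
Lemma has_der_comp_seq (U : set Cn) (g : Cn -> R) (I : Type) (s : seq I)
    (b : I -> Cn) (c : I -> R -> R) (dc : I -> R) (z : Cn) :
  nbhs z U -> (forall v y, U y -> dirdiff g v y) ->
  (forall v, {for z, continuous (dirder g v)}) ->
  (forall i, c i 0 = 0) -> (forall i, has_der (c i) 0 (dc i)) ->
  has_der (fun t => g (z + \sum_(i <- s) ((c i t)%:C : C) *: b i)) 0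
    (\sum_(i <- s) dc i * dirder g (b i) z).
Proof.
move=> zU gU gc c0 cd.
have pc (s' : seq I) : {for 0, continuous (fun t => z + \sum_(i <- s') ((c i t)%:C : C) *: b i)}.
  elim: s' => [|i s' IH].
    have -> : (fun t => z + \sum_(i <- [::]) ((c i t)%:C : C) *: b i) = cst z.
      by apply/funext => t; rewrite big_nil addr0.
    exact: cst_continuous.
  have E t : z + \sum_(i <- i :: s') ((c i t)%:C : C) *: b i =
      z + \sum_(i <- s') ((c i t)%:C : C) *: b i + ((c i t)%:C : C) *: b i.
    by rewrite big_cons addrCA addrC.
  rewrite (funext E); apply: cvg_along; first exact: IH.
  exact: has_der_cont (cd i).
elim: s => [|i s IH].
  rewrite big_nil.
  have -> : (fun t => g (z + \sum_(i <- [::]) ((c i t)%:C : C) *: b i)) = cst (g z).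
    by apply/funext => t; rewrite big_nil addr0.
  exact: has_der_cst.
have p0 : z + \sum_(i <- s) ((c i 0)%:C : C) *: b i = z.
  by rewrite big1 ?addr0 // => j _; rewrite c0 scale0r.
have := has_derD (has_der_increment zU (gU (b i)) (gc (b i)) (pc s) p0 (c0 i) (cd i)) IH.
have E t : z + \sum_(i <- i :: s) ((c i t)%:C : C) *: b i =
    z + \sum_(i <- s) ((c i t)%:C : C) *: b i + ((c i t)%:C : C) *: b i.
  by rewrite big_cons addrCA addrC.
rewrite big_cons (funext (fun t => congr1 g (E t))).
congr has_der; apply/funext => t; exact: subrK.
Qed.

End RealCalculus.

(** * Chain rule and symmetry of second derivatives, over the real basis e_j, i e_j of C^n *)

Section ChainRule.
Variables (R : realType) (n : nat).
Local Notation C := (Cx R).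
Local Notation Cn := 'rV[C]_n.
Definition cbasis (i : 'I_n * bool) : Cn :=
  (if i.2 then ('i%C : C) else 1) *: delta_mx 0 i.1.

Definition ccoord (z : Cn) (i : 'I_n * bool) : R :=
  if i.2 then complex.Im (z 0 i.1) else complex.Re (z 0 i.1).

Lemma cbasis_sum (z : Cn) : z = \sum_i ((ccoord z i)%:C : C) *: cbasis i.
Proof.
rewrite [LHS]row_sum_delta.
transitivity (\sum_(j < n) \sum_(e : bool) ((ccoord z (j, e))%:C : C) *: cbasis (j, e)); last first.
  by rewrite pair_bigA; apply: eq_bigr => -[j e].
apply: eq_bigr => j _; rewrite big_bool /cbasis /ccoord /= !scalerA -scalerDl.
by congr (_ *: _); case: (z 0 j) => x y; simpc.
Qed.

(** The curve is written as [p 0] plus its coordinate increments along the real basis, whose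
    coefficients vanish at 0. *)
Lemma has_der_comp_coord (U : set Cn) (g : Cn -> R) (p : R -> Cn) (d : Cn) :
  nbhs (p 0) U -> (forall v y, U y -> dirdiff g v y) ->
  (forall v, {for p 0, continuous (dirder g v)}) ->
  (forall i, has_der (fun t => ccoord (p t) i) 0 (ccoord d i)) ->
  has_der (g \o p) 0 (\sum_i ccoord d i * dirder g (cbasis i) (p 0)).
Proof.
move=> zU gU gc pd.
have := @has_der_comp_seq R n U g _ (index_enum _) cbasis
  (fun i t => ccoord (p t) i - ccoord (p 0) i) (ccoord d) (p 0) zU gU gc.
have -> : (fun t => g (p 0 +
    \sum_i ((ccoord (p t) i - ccoord (p 0) i)%:C : C) *: cbasis i)) = g \o p.
  apply/funext => t /=; congr g.
  under eq_bigr do rewrite rmorphB scalerBl.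
  by rewrite sumrB -!cbasis_sum addrC subrK.
apply=> i; first exact: subrr.
by rewrite -[X in has_der _ _ X]subr0; apply: has_derB => //; exact: has_der_cst.
Qed.

Lemma ccoordD (y z : Cn) i : ccoord (y + z) i = ccoord y i + ccoord z i.
Proof. by rewrite /ccoord !mxE; case: ifP => _; rewrite raddfD. Qed.

Lemma ccoordZ (a : R) (z : Cn) i : ccoord ((a%:C : C) *: z) i = a * ccoord z i.
Proof. by rewrite /ccoord !mxE; case: ifP => _; case: (z 0 i.1) => x y /=; ring. Qed.

(** The chain rule along a straight line. This is the source of linearity in the direction, which
    the mere existence of directional derivatives does not give. *)
Lemma dirderE (U : set Cn) (g : Cn -> R) (z v : Cn) :
  nbhs z U -> (forall v y, U y -> dirdiff g v y) ->
  (forall v, {for z, continuous (dirder g v)}) ->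
  dirder g v z = \sum_i ccoord v i * dirder g (cbasis i) z.
Proof.
move=> zU gU gc.
have z0 : z + ((0 : R)%:C : C) *: v = z by rewrite scale0r addr0.
apply: has_der_unique.
have := @has_der_comp_coord U g (fun t : R => z + (t%:C : C) *: v) v.
rewrite z0; apply => // i.
have -> : (fun t : R => ccoord (z + (t%:C : C) *: v) i) =
    (fun t => ccoord z i + ccoord v i * t).
  by apply/funext => t; rewrite ccoordD ccoordZ [t * _]mulrC.
rewrite -[X in has_der _ _ X]add0r; apply: has_derD; first exact: has_der_cst.
rewrite -[X in has_der _ _ X]mulr1; exact/has_derZ/has_der_id.
Qed.

Lemma has_der_comp_dirder (U : set Cn) (g : Cn -> R) (p : R -> Cn) (d : Cn) :
  nbhs (p 0) U -> (forall v y, U y -> dirdiff g v y) ->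
  (forall v, {for p 0, continuous (dirder g v)}) ->
  (forall i, has_der (fun t => ccoord (p t) i) 0 (ccoord d i)) ->
  has_der (g \o p) 0 (dirder g d (p 0)).
Proof.
move=> zU gU gc pd; rewrite (dirderE _ zU gU gc).
exact: has_der_comp_coord zU gU gc pd.
Qed.

(** The mean value theorem is used twice: along v for the difference [G] of g across the w-side of
    the square, then along w for [dirder g v]. *)
Lemma mean_value_square (g : Cn -> R) (z v w : Cn) (e : R) (W : set Cn) :
  (forall s t : R, `|s| <= `|e| -> `|t| <= `|e| ->
     W (z + (s%:C : C) *: v + (t%:C : C) *: w)) ->
  (forall y, W y -> dirdiff g v y) -> (forall y, W y -> dirdiff (dirder g v) w y) ->
  exists2 y, W y & g (z + (e%:C : C) *: v + (e%:C : C) *: w) - g (z + (e%:C : C) *: v)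
     - g (z + (e%:C : C) *: w) + g z = dirder (dirder g v) w y * e * e.
Proof.
move=> eW gv gvw; pose G (y : Cn) := g (y + (e%:C : C) *: w) - g y.
have WG (s : R) : `|s| <= `|e| -> has_der (along G v (z + (s%:C : C) *: v)) 0
    (dirder g v (z + (s%:C : C) *: v + (e%:C : C) *: w) - dirder g v (z + (s%:C : C) *: v)).
  move=> se.
  have h1 : dirdiff g v (z + (s%:C : C) *: v + (e%:C : C) *: w) by apply/gv/eW.
  have h0 : dirdiff g v (z + (s%:C : C) *: v).
    by have := eW s 0 se; rewrite normr0 normr_ge0 scale0r addr0 => /(_ erefl)/gv.
  have := has_derB (dirdiffP h1) (dirdiffP h0).
  congr has_der; apply/funext => t; rewrite /along /G.
  by rewrite addrAC.
have GD (s : R) : `|s| <= `|e| -> dirdiff G v (z + (s%:C : C) *: v).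
  by move=> /WG; case.
have [s se E] := mean_value_along GD.
have dE : dirder G v (z + (s%:C : C) *: v) =
   dirder g v (z + (s%:C : C) *: v + (e%:C : C) *: w) - dirder g v (z + (s%:C : C) *: v).
  exact: has_der_unique (WG s se).
have [t te tE] := @mean_value_along R n (dirder g v) w (z + (s%:C : C) *: v) e
   (fun t te => gvw _ (eW s t se te)).
exists (z + (s%:C : C) *: v + (t%:C : C) *: w); first exact: eW.
by rewrite -tE -dE -E /G; ring.
Qed.

(* Both sides are limits of the second difference quotient of g over a square. *)
Lemma dirderC (U : set Cn) (g : Cn -> R) (z v w : Cn) :
  nbhs z U -> (forall u y, U y -> dirdiff g u y) ->
  (forall u u' y, U y -> dirdiff (dirder g u) u' y) ->
  (forall u u', {for z, continuous (dirder (dirder g u) u')}) ->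
  dirder (dirder g v) w z = dirder (dirder g w) v z.
Proof.
move=> zU g1 g2 gc; set A := LHS; set B := RHS.
apply/eqP; rewrite -subr_eq0 -normr_le0; apply/ler_addgt0Pr => e e0; rewrite add0r.
have e20 : 0 < e / 2 by lra.
pose W := [set y | U y /\ (`|A - dirder (dirder g v) w y| < e / 2 /\
                           `|B - dirder (dirder g w) v y| < e / 2)].
have zW : nbhs z W.
  apply: filterI => //; apply: filterI.
    by have /cvgrPdist_lt := gc v w; apply.
  by have /cvgrPdist_lt := gc w v; apply.
(* [a] bounds the side of the square along w and [b] the side along v; half their minimum keeps both
   bounds strict. *)
have [a a0 /(nbhs_segment v)[b b0 zab]] := nbhs_segment w zW.
pose d := Num.min a b / 2.
have d0 : 0 < d by rewrite divr_gt0 // lt_min a0 b0.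
have [da db] : d < a /\ d < b.
  have : d < Num.min a b.
    rewrite /d; have : 0 < Num.min a b by rewrite lt_min a0 b0.
    by move: (Num.min a b) => m; lra.
  by rewrite lt_min => /andP.
have dW (s t : R) : `|s| <= `|d| -> `|t| <= `|d| ->
     W (z + (s%:C : C) *: v + (t%:C : C) *: w).
  rewrite (gtr0_norm d0) => sd td.
  by apply: (nbhs_singleton zab); apply: le_lt_trans; eassumption.
have dW' (s t : R) : `|s| <= `|d| -> `|t| <= `|d| ->
     W (z + (s%:C : C) *: w + (t%:C : C) *: v).
  by move=> sd td; rewrite addrAC; exact: dW.
have [y1 [_ [y1A _]] E1] :=
  mean_value_square dW (fun y Wy => g1 v y Wy.1) (fun y Wy => g2 v w y Wy.1).
have [y2 [_ [_ y2B]] E2] :=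
  mean_value_square dW' (fun y Wy => g1 w y Wy.1) (fun y Wy => g2 w v y Wy.1).
(* Exchanging v and w only exchanges the two middle corners of the square, so both mixed derivatives
   are the same second difference divided by d^2. *)
have y12 : dirder (dirder g v) w y1 = dirder (dirder g w) v y2.
  have zC : z + (d%:C : C) *: v + (d%:C : C) *: w = z + (d%:C : C) *: w + (d%:C : C) *: v.
    exact: addrAC.
  apply: (mulIf (lt0r_neq0 d0)); apply: (mulIf (lt0r_neq0 d0)).
  apply: etrans (esym E1) _; apply: etrans _ E2.
  by congr (_ + _); apply: etrans (addrAC _ _ _) _; congr (g _ - _ - _).
rewrite -y12 distrC in y2B.
have AB := ler_normD (A - dirder (dirder g v) w y1) (dirder (dirder g v) w y1 - B).
rewrite subrKA in AB; apply: (le_trans AB).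
by rewrite (splitr e); exact: ltW (ltrD y1A y2B).
Qed.

End ChainRule.

(** * Smooth complex functions *)

Section ComplexCalculus.
Variables (R : realType) (n : nat).
Local Notation C := (Cx R).
Local Notation Cn := 'rV[C]_n.
Implicit Types (f g : Cn -> C) (u v w z : Cn) (U : set Cn).

(** A relation rather than a function, so that differentiability and the value of the derivative
    travel through the rules together. *)
Definition cder (p : R -> C) (d : C) : Prop :=
  has_der (fun t => complex.Re (p t)) 0 (complex.Re d) /\
  has_der (fun t => complex.Im (p t)) 0 (complex.Im d).

Lemma cder_cst (c : C) : cder (fun=> c) 0.
Proof. by split; exact: has_der_cst. Qed.

Lemma ReD (x y : C) : complex.Re (x + y) = complex.Re x + complex.Re y.
Proof. by case: x y => [a b] [c d]. Qed.

Lemma ImD (x y : C) : complex.Im (x + y) = complex.Im x + complex.Im y.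
Proof. by case: x y => [a b] [c d]. Qed.

Lemma ReM (x y : C) : complex.Re (x * y) =
  complex.Re x * complex.Re y - complex.Im x * complex.Im y.
Proof. by case: x y => [a b] [c d]. Qed.

Lemma ImM (x y : C) : complex.Im (x * y) =
  complex.Re x * complex.Im y + complex.Im x * complex.Re y.
Proof. by case: x y => [a b] [c d]. Qed.

Lemma cderD (p q : R -> C) (c d : C) :
  cder p c -> cder q d -> cder (fun t => p t + q t) (c + d).
Proof.
move=> [p1 p2] [q1 q2]; split.
  by rewrite ReD (funext (fun t => ReD (p t) (q t))); exact: has_derD.
by rewrite ImD (funext (fun t => ImD (p t) (q t))); exact: has_derD.
Qed.

Lemma cderM (p q : R -> C) (c d : C) :
  cder p c -> cder q d -> cder (fun t => p t * q t) (c * q 0 + p 0 * d).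
Proof.
move=> [p1 p2] [q1 q2]; split.
  rewrite (funext (fun t => ReM (p t) (q t))) ReD !ReM.
  have := has_derB (has_derM p1 q1) (has_derM p2 q2); congr has_der; ring.
rewrite (funext (fun t => ImM (p t) (q t))) ImD !ImM.
have := has_derD (has_derM p1 q2) (has_derM p2 q1); congr has_der; ring.
Qed.

Lemma cderZ (a : C) (p : R -> C) (c : C) : cder p c -> cder (fun t => a * p t) (a * c).
Proof. by move=> pc; have := cderM (cder_cst a) pc; rewrite mul0r add0r. Qed.

Lemma ReJ (x : C) : complex.Re (Num.conj x) = complex.Re x.
Proof. by case: x => a b. Qed.

Lemma ImJ (x : C) : complex.Im (Num.conj x) = - complex.Im x.
Proof. by case: x => a b. Qed.

Lemma cder_conj (p : R -> C) (c : C) :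
  cder p c -> cder (fun t => Num.conj (p t)) (Num.conj c).
Proof.
move=> [p1 p2]; split.
  by rewrite ReJ (funext (fun t => ReJ (p t))).
by rewrite ImJ (funext (fun t => ImJ (p t))); exact: has_derN.
Qed.

Lemma rderivableP f v z : rderivable f v z <->
  cder (fun t : R => f (z + (t%:C : C) *: v)) (rderive f v z).
Proof.
split=> [[f1 f2]|[f1 f2]]; last by split; [case: f1|case: f2].
by split; [exact: has_der_derive1 f1|exact: has_der_derive1 f2].
Qed.

Lemma cder_rderive f v z (d : C) :
  cder (fun t : R => f (z + (t%:C : C) *: v)) d ->
  rderivable f v z /\ rderive f v z = d.
Proof.
move=> [f1 f2]; split; first by split; [case: f1|case: f2].
case: d f1 f2 => a b f1 f2.
by rewrite /rderive (has_der_unique f1) (has_der_unique f2).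
Qed.

Lemma add_scale0 z v : z + ((0 : R)%:C : C) *: v = z.
Proof. by rewrite scale0r addr0. Qed.

Lemma rderivable_cst (c : C) v z :
  rderivable (fun=> c) v z /\ rderive (fun=> c) v z = 0.
Proof. exact/cder_rderive/cder_cst. Qed.

Lemma rderivableD f g v z : rderivable f v z -> rderivable g v z ->
  rderivable (fun y => f y + g y) v z /\
  rderive (fun y => f y + g y) v z = rderive f v z + rderive g v z.
Proof. by move=> /rderivableP ? /rderivableP ?; exact/cder_rderive/cderD. Qed.

Lemma rderivableM f g v z : rderivable f v z -> rderivable g v z ->
  rderivable (fun y => f y * g y) v z /\
  rderive (fun y => f y * g y) v z = rderive f v z * g z + f z * rderive g v z.
Proof.
move=> /rderivableP hf /rderivableP hg; apply: cder_rderive.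
by have := cderM hf hg; rewrite add_scale0.
Qed.

Lemma rderivableZ (a : C) f v z : rderivable f v z ->
  rderivable (fun y => a * f y) v z /\ rderive (fun y => a * f y) v z = a * rderive f v z.
Proof. by move=> /rderivableP ?; exact/cder_rderive/cderZ. Qed.

Lemma rderivable_conj f v z : rderivable f v z ->
  rderivable (fun y => Num.conj (f y)) v z /\
  rderive (fun y => Num.conj (f y)) v z = Num.conj (rderive f v z).
Proof. by move=> /rderivableP ?; exact/cder_rderive/cder_conj. Qed.

Lemma nbhs_along U z v : open U -> U z ->
  \forall t \near (0 : R), U (z + (t%:C : C) *: v).
Proof.
move=> oU Uz; have [e e0 /nbhs_singleton zW] := nbhs_segment v (open_nbhs_nbhs (conj oU Uz)).
apply/nbhs_ballP; exists e => //= t; rewrite /ball /= sub0r normrN; exact: zW.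
Qed.

Lemma has_der_near (p q : R -> R) (d : R) :
  (\forall t \near (0 : R), p t = q t) -> has_der p 0 d -> has_der q 0 d.
Proof.
move=> pq [pd <-]; split; first exact: near_eq_derivable pq pd.
by rewrite -(near_eq_derive _ pq).
Qed.

Lemma rderivable_near U f g v z : open U -> U z -> (forall y, U y -> f y = g y) ->
  rderivable f v z -> rderivable g v z /\ rderive g v z = rderive f v z.
Proof.
move=> oU Uz fg /rderivableP[f1 f2]; apply: cder_rderive.
by split; [apply: has_der_near f1|apply: has_der_near f2];
  apply: (filterS _ (nbhs_along v oU Uz)) => t Ut; rewrite fg.
Qed.

End ComplexCalculus.

(** * Closure properties of smooth functions *)

Section SmoothFunctions.
Variables (R : realType) (n : nat).
Local Notation C := (Cx R).
Local Notation Cn := 'rV[C]_n.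
Implicit Types (f g : Cn -> C) (u v w z : Cn) (U : set Cn).

Lemma continuous_on_eq U f g z : open U -> U z -> (forall y, U y -> f y = g y) ->
  {for z, continuous f} -> {for z, continuous g}.
Proof.
move=> oU Uz fg fc; suff : g y @[y --> z] --> g z by [].
rewrite -(fg z Uz).
have zU : \forall y \near z, f y = g y.
  by apply: (@filterS _ _ (nbhs_filter z) _ _ _ (open_nbhs_nbhs (conj oU Uz))) => y /fg.
exact: cvg_trans (near_eq_cvg zU) fc.
Qed.

(** The rules for derivatives hold only at points of U. As U is open, this congruence lets the
    inductions below replace the derivative of a sum, product by a constant or conjugate by its
    expression on U. *)
Lemma Ck_on_eq k U f g : open U -> (forall y, U y -> f y = g y) ->
  Ck_on k U f -> Ck_on k U g.
Proof.
move=> oU; elim: k f g => [|k IH] f g fg [fc fd]; split.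
- by move=> z Uz; exact: (continuous_on_eq oU Uz fg (fc z Uz)).
- exact: I.
- by move=> z Uz; exact: (continuous_on_eq oU Uz fg (fc z Uz)).
- move=> v; have [fdv fCk] := fd v.
  have H z (Uz : U z) := rderivable_near oU Uz fg (fdv z Uz).
  split; first by move=> z Uz; exact: (H z Uz).1.
  by apply: IH fCk => z Uz; rewrite (H z Uz).2.
Qed.

Lemma Ck_on_cst k U (c : C) : open U -> Ck_on k U (fun=> c).
Proof.
move=> oU; have cc (a : C) : forall z, U z -> {for z, continuous (fun=> a : C)}.
  by move=> z _; exact: cst_continuous.
elim: k c => [|k IH] c; split; [exact: cc|exact: I|exact: cc|move=> v].
split=> [z _|]; first exact: (rderivable_cst c v z).1.
by apply: Ck_on_eq (IH 0) => // z _; rewrite (rderivable_cst c v z).2.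
Qed.

Lemma Ck_onD k U f g : open U -> Ck_on k U f -> Ck_on k U g ->
  Ck_on k U (fun y => f y + g y).
Proof.
move=> oU.
have cc f' g' z : {for z, continuous f'} -> {for z, continuous g'} ->
    {for z, continuous (fun y => f' y + g' y : C)}.
  by move=> fc gc; exact: (cvgD fc gc).
elim: k f g => [|k IH] f g [fc fd] [gc gd]; split.
- by move=> z Uz; exact: cc (fc z Uz) (gc z Uz).
- exact: I.
- by move=> z Uz; exact: cc (fc z Uz) (gc z Uz).
- move=> v; have [f1 f2] := fd v; have [g1 g2] := gd v.
  have H z (Uz : U z) := rderivableD (f1 z Uz) (g1 z Uz).
  split; first by move=> z Uz; exact: (H z Uz).1.
  by apply: Ck_on_eq (IH _ _ f2 g2) => // z Uz; rewrite (H z Uz).2.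
Qed.

Lemma Ck_onZ k U (a : C) f : open U -> Ck_on k U f -> Ck_on k U (fun y => a * f y).
Proof.
move=> oU.
have cc f' z : {for z, continuous f'} -> {for z, continuous (fun y => a * f' y : C)}.
  by move=> fc; exact: (cvgM (cvg_cst a) fc).
elim: k f => [|k IH] f [fc fd]; split.
- by move=> z Uz; exact: cc (fc z Uz).
- exact: I.
- by move=> z Uz; exact: cc (fc z Uz).
- move=> v; have [f1 f2] := fd v.
  have H z (Uz : U z) := rderivableZ a (f1 z Uz).
  split; first by move=> z Uz; exact: (H z Uz).1.
  by apply: Ck_on_eq (IH _ f2) => // z Uz; rewrite (H z Uz).2.
Qed.

Lemma cvg_conj (T : Type) (F : set_system T) (FF : Filter F) (p : T -> C) (l : C) :
  p x @[x --> F] --> l -> Num.conj (p x) @[x --> F] --> Num.conj l.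
Proof.
move=> /cvgrPdist_lt pl; apply/cvgrPdist_lt => e /pl.
by apply: filterS => x; rewrite -rmorphB norm_conjC.
Qed.

Lemma continuous_conj f z : {for z, continuous f} ->
  {for z, continuous (fun y => Num.conj (f y))}.
Proof. by move=> fc; exact: (cvg_conj (nbhs_filter z) fc). Qed.

Lemma Ck_on_conj k U f : open U -> Ck_on k U f -> Ck_on k U (fun y => Num.conj (f y)).
Proof.
move=> oU; elim: k f => [|k IH] f [fc fd]; split.
- by move=> z Uz; exact: continuous_conj (fc z Uz).
- exact: I.
- by move=> z Uz; exact: continuous_conj (fc z Uz).
- move=> v; have [f1 f2] := fd v.
  have H z (Uz : U z) := rderivable_conj (f1 z Uz).
  split; first by move=> z Uz; exact: (H z Uz).1.
  by apply: Ck_on_eq (IH _ f2) => // z Uz; rewrite (H z Uz).2.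
Qed.

Lemma smooth_on_eq U f g : open U -> (forall y, U y -> f y = g y) ->
  smooth_on U f -> smooth_on U g.
Proof. by move=> oU fg fs k; exact: Ck_on_eq (fs k). Qed.

Lemma smooth_on_cst U (c : C) : open U -> smooth_on U (fun=> c).
Proof. by move=> oU k; exact: Ck_on_cst. Qed.

Lemma smooth_onD U f g : open U -> smooth_on U f -> smooth_on U g ->
  smooth_on U (fun y => f y + g y).
Proof. by move=> oU fs gs k; exact: Ck_onD. Qed.

Lemma smooth_onZ U (a : C) f : open U -> smooth_on U f -> smooth_on U (fun y => a * f y).
Proof. by move=> oU fs k; exact: Ck_onZ. Qed.

Lemma smooth_on_conj U f : open U -> smooth_on U f -> smooth_on U (fun y => Num.conj (f y)).
Proof. by move=> oU fs k; exact: Ck_on_conj. Qed.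

Lemma smooth_on_sum U (I : Type) (s : seq I) (F : I -> Cn -> C) : open U ->
  (forall i, smooth_on U (F i)) -> smooth_on U (fun y => \sum_(i <- s) F i y).
Proof.
move=> oU Fs; elim: s => [|i s IH].
  by apply: smooth_on_eq (smooth_on_cst 0 oU) => // y _; rewrite big_nil.
by apply: smooth_on_eq (smooth_onD oU (Fs i) IH) => // y _; rewrite big_cons.
Qed.

Lemma smooth_on_rderive U f v : smooth_on U f -> smooth_on U (rderive f v).
Proof. by move=> fs k; have [_ /(_ v)[]] := fs k.+1. Qed.

Lemma smooth_on_rderivable U f v z : smooth_on U f -> U z -> rderivable f v z.
Proof. by move=> fs; have [_ /(_ v)[H _]] := fs 1; exact: H. Qed.

Lemma smooth_on_cont U f z : smooth_on U f -> U z -> {for z, continuous f}.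
Proof. by move=> fs; have [H _] := fs 0; exact: H. Qed.

Section AtPoint.
Variables (U : set Cn) (z : Cn) (oU : open U) (Uz : U z).

Let zU : nbhs z U. Proof. exact: open_nbhs_nbhs. Qed.

Let smooth_Re f : smooth_on U f ->
  (forall v y, U y -> dirdiff (fun x => complex.Re (f x)) v y) /\
  (forall v, {for z, continuous (dirder (fun x => complex.Re (f x)) v)}).
Proof.
move=> fs; split=> [v y Uy|v]; first exact: (smooth_on_rderivable v fs Uy).1.
exact: (cvg_Re (nbhs_filter z) (smooth_on_cont (smooth_on_rderive v fs) Uz)).
Qed.

Let smooth_Im f : smooth_on U f ->
  (forall v y, U y -> dirdiff (fun x => complex.Im (f x)) v y) /\
  (forall v, {for z, continuous (dirder (fun x => complex.Im (f x)) v)}).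
Proof.
move=> fs; split=> [v y Uy|v]; first exact: (smooth_on_rderivable v fs Uy).2.
exact: (cvg_Im (nbhs_filter z) (smooth_on_cont (smooth_on_rderive v fs) Uz)).
Qed.

Lemma rderive_comp f (p : R -> Cn) (d : Cn) : smooth_on U f -> p 0 = z ->
  (forall j, cder (fun t => p t 0 j) (d 0 j)) ->
  cder (fun t => f (p t)) (rderive f d z).
Proof.
move=> fs p0 pd.
have pc i : has_der (fun t => ccoord (p t) i) 0 (ccoord d i).
  by rewrite /ccoord; case: i => j [] /=; case: (pd j).
have [r1 r2] := smooth_Re fs; have [i1 i2] := smooth_Im fs.
have zU' := zU; rewrite -p0 in r2 i2 zU' *; split.
  exact: (has_der_comp_dirder zU' r1 r2 pc).
exact: (has_der_comp_dirder zU' i1 i2 pc).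
Qed.

Lemma rderiveE f v : smooth_on U f ->
  rderive f v z = \sum_i ((ccoord v i)%:C : C) * rderive f (cbasis R i) z.
Proof.
move=> fs; have [r1 r2] := smooth_Re fs; have [i1 i2] := smooth_Im fs.
have e1 := dirderE v zU r1 r2; have e2 := dirderE v zU i1 i2.
transitivity ((\sum_i ccoord v i * dirder (fun y => complex.Re (f y)) (cbasis R i) z)
  +i* (\sum_i ccoord v i * dirder (fun y => complex.Im (f y)) (cbasis R i) z) : C).
  by rewrite -e1 -e2.
elim/big_rec3 : _ => // i a b c _ <-.
by rewrite /rderive /dirder; simpc.
Qed.

Lemma rderiveDv f u v : smooth_on U f ->
  rderive f (u + v) z = rderive f u z + rderive f v z.
Proof.
move=> fs; rewrite !(rderiveE _ fs) -big_split; apply: eq_bigr => i _.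
by rewrite ccoordD realCD mulrDl.
Qed.

Lemma rderiveZv f (a : R) v : smooth_on U f ->
  rderive f ((a%:C : C) *: v) z = (a%:C : C) * rderive f v z.
Proof.
move=> fs; rewrite !(rderiveE _ fs) mulr_sumr; apply: eq_bigr => i _.
by rewrite ccoordZ realCM mulrA.
Qed.

Lemma rderiveC f v w : smooth_on U f ->
  rderive (rderive f v) w z = rderive (rderive f w) v z.
Proof.
move=> fs.
have r := @dirderC R n U (fun y => complex.Re (f y)) z v w zU.
have i := @dirderC R n U (fun y => complex.Im (f y)) z v w zU.
suff h : dirder (dirder (fun y => complex.Re (f y)) v) w z =
     dirder (dirder (fun y => complex.Re (f y)) w) v z /\
  dirder (dirder (fun y => complex.Im (f y)) v) w z =
     dirder (dirder (fun y => complex.Im (f y)) w) v z.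
  by case: h => h1 h2; exact: (congr2 (fun a b => (a +i* b : C)) h1 h2).
split.
- apply: r => [u y Uy|u u' y Uy|u u'].
  + exact: (smooth_on_rderivable u fs Uy).1.
  + exact: (smooth_on_rderivable u' (smooth_on_rderive u fs) Uy).1.
  + have fss := smooth_on_rderive u' (smooth_on_rderive u fs).
    exact: (cvg_Re (nbhs_filter z) (smooth_on_cont fss Uz)).
- apply: i => [u y Uy|u u' y Uy|u u'].
  + exact: (smooth_on_rderivable u fs Uy).2.
  + exact: (smooth_on_rderivable u' (smooth_on_rderive u fs) Uy).2.
  + have fss := smooth_on_rderive u' (smooth_on_rderive u fs).
    exact: (cvg_Im (nbhs_filter z) (smooth_on_cont fss Uz)).
Qed.

End AtPoint.
End SmoothFunctions.

(** * Wirtinger derivatives *)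

Section WirtingerAlgebra.
Variables (F : comNzRingType) (i h : F).
Implicit Types a b c d x y e : F.

(** Here [i] stands for the imaginary unit and [h] for 1/2. These identities hold for arbitrary
    values of both, except [wirt_algZ], where i^2 = -1 enters. *)
Lemma wirt_algD a b c d : (a + b - i * (c + d)) * h = (a - i * c) * h + (b - i * d) * h.
Proof. by ring. Qed.

Lemma wirt_algM a b c d x y :
  (a * x + b * c - i * (d * x + b * y)) * h = (a - i * d) * h * x + b * ((c - i * y) * h).
Proof. by ring. Qed.

Lemma wirt_algZ d e x y : i * i = -1 ->
  (x * d + y * e - i * (x * e + y * - d)) * h = (x + y * i) * ((d - i * e) * h).
Proof.
move=> ii; transitivity ((x * d + y * e - i * (x * e - y * d) - (i * i + 1) * (y * e)) * h).
  by rewrite ii addNr mul0r subr0 mulrN.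
by ring.
Qed.

Lemma wirt_algC a b c d a' b' c' d' e e' : a = a' -> b = b' -> c = c' -> d = d' ->
  ((a + e' * b) * h + e * ((c + e' * d) * h)) * h =
  ((a' + e * c') * h + e' * ((b' + e * d') * h)) * h.
Proof. by move=> -> -> -> ->; ring. Qed.

End WirtingerAlgebra.

Section Wirtinger.
Variables (R : realType) (n : nat).
Local Notation C := (Cx R).
Local Notation Cn := 'rV[C]_n.
Implicit Types (f g : Cn -> C) (u v w z : Cn) (U : set Cn).
Local Notation iC := ('i%C : C).

Lemma iCM : iC * iC = -1.
Proof. by rewrite -expr2; exact: sqr_i. Qed.

(** Differentiability along v and i v is recorded with the value, since the value of [wirt] alone
    cannot be carried through sums and products. *)
Definition is_wirt f v z (d : C) : Prop :=
  [/\ rderivable f v z, rderivable f (iC *: v) z & wirt f v z = d].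

Lemma is_wirt_cst (c : C) v z : is_wirt (fun=> c) v z 0.
Proof.
have [c1 e1] := rderivable_cst c v z.
have [c2 e2] := rderivable_cst c (iC *: v) z.
by split=> //; rewrite /wirt e1 e2 mulr0 subr0 mul0r.
Qed.

Lemma is_wirtD f g v z (a b : C) : is_wirt f v z a -> is_wirt g v z b ->
  is_wirt (fun y => f y + g y) v z (a + b).
Proof.
move=> [f1 f2 <-] [g1 g2 <-].
have [h1 e1] := rderivableD f1 g1.
have [h2 e2] := rderivableD f2 g2.
split; [exact: h1|exact: h2|]; by rewrite /wirt e1 e2; exact: wirt_algD.
Qed.

Lemma is_wirtM f g v z (a b : C) : is_wirt f v z a -> is_wirt g v z b ->
  is_wirt (fun y => f y * g y) v z (a * g z + f z * b).
Proof.
move=> [f1 f2 <-] [g1 g2 <-].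
have [h1 e1] := rderivableM f1 g1.
have [h2 e2] := rderivableM f2 g2.
split; [exact: h1|exact: h2|]; by rewrite /wirt e1 e2; exact: wirt_algM.
Qed.

Lemma is_wirtZ (c : C) f v z (a : C) : is_wirt f v z a ->
  is_wirt (fun y => c * f y) v z (c * a).
Proof. by move=> h; have := is_wirtM (is_wirt_cst c v z) h; rewrite mul0r add0r. Qed.

Lemma is_wirt_near U f g v z (a : C) : open U -> U z ->
  (forall y, U y -> f y = g y) -> is_wirt f v z a -> is_wirt g v z a.
Proof.
move=> oU Uz fg [f1 f2 <-].
have [h1 e1] := rderivable_near oU Uz fg f1.
have [h2 e2] := rderivable_near oU Uz fg f2.
split; [exact: h1|exact: h2|]; by rewrite /wirt e1 e2.
Qed.

Lemma is_wirt_sum (I : Type) (s : seq I) (F : I -> Cn -> C) v z (a : I -> C) :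
  (forall i, is_wirt (F i) v z (a i)) ->
  is_wirt (fun y => \sum_(i <- s) F i y) v z (\sum_(i <- s) a i).
Proof.
move=> Fa; elim: s => [|i s IH].
  rewrite big_nil; under [X in is_wirt X]eq_fun do rewrite big_nil.
  exact: is_wirt_cst.
rewrite big_cons; under [X in is_wirt X]eq_fun do rewrite big_cons.
exact: is_wirtD.
Qed.

Lemma wirt_near U f g v z : open U -> U z -> (forall y, U y -> f y = g y) ->
  smooth_on U f -> wirt g v z = wirt f v z.
Proof.
move=> oU Uz fg fs; have [] // := @is_wirt_near U f g v z (wirt f v z) oU Uz fg.
by split=> //; exact: smooth_on_rderivable fs Uz.
Qed.

Lemma smooth_is_wirt U f v z : smooth_on U f -> U z -> is_wirt f v z (wirt f v z).
Proof. by move=> fs Uz; split=> //; exact: smooth_on_rderivable fs Uz. Qed.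

Lemma is_wirtE f v z (a : C) : is_wirt f v z a -> wirt f v z = a.
Proof. by case. Qed.

Lemma smooth_on_wirt U f v : open U -> smooth_on U f -> smooth_on U (wirt f v).
Proof.
move=> oU fs.
have h := smooth_onZ (2%:R^-1 : C) oU (smooth_onD oU (smooth_on_rderive v fs)
  (smooth_onZ (- iC) oU (smooth_on_rderive (iC *: v) fs))).
by apply: smooth_on_eq h => // y _; rewrite mulNr mulrC.
Qed.

Lemma smooth_on_wirtbar U f v : open U -> smooth_on U f -> smooth_on U (wirtbar f v).
Proof.
move=> oU fs.
have h := smooth_onZ (2%:R^-1 : C) oU (smooth_onD oU (smooth_on_rderive v fs)
  (smooth_onZ iC oU (smooth_on_rderive (iC *: v) fs))).
by apply: smooth_on_eq h => // y _; rewrite mulrC.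
Qed.

Lemma conj_iC : Num.conj iC = - iC.
Proof. by apply/eqP; rewrite eq_complex /= oppr0 !eqxx. Qed.

Lemma conj_half (x : C) : Num.conj (x / 2%:R) = Num.conj x / 2%:R.
Proof. by rewrite rmorphM fmorphV rmorph_nat. Qed.

(** Conjugation exchanges the two Wirtinger derivatives because it sends i to -i; the conjugacy of d
    and dbar rests on this. *)
Lemma wirt_conj U f v z : smooth_on U f -> U z ->
  wirt (fun y => Num.conj (f y)) v z = Num.conj (wirtbar f v z).
Proof.
move=> fs Uz.
have [_ e1] := rderivable_conj (smooth_on_rderivable v fs Uz).
have [_ e2] := rderivable_conj (smooth_on_rderivable (iC *: v) fs Uz).
rewrite /wirt /wirtbar conj_half e1 e2 rmorphD rmorphM; congr (_ / _).
by congr (_ + _); rewrite -mulNr; congr (_ * _); exact: esym conj_iC.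
Qed.

Lemma is_wirt_conj U f v z : smooth_on U f -> U z ->
  is_wirt (fun y => Num.conj (f y)) v z (Num.conj (wirtbar f v z)).
Proof.
move=> fs Uz.
have [h1 _] := rderivable_conj (smooth_on_rderivable v fs Uz).
have [h2 _] := rderivable_conj (smooth_on_rderivable (iC *: v) fs Uz).
by split=> //; exact: wirt_conj fs Uz.
Qed.

(* The parameter e is -i for wirt and i for wirtbar. *)
Definition wirtinger (e : C) f v y : C :=
  (rderive f v y + e * rderive f (iC *: v) y) / 2%:R.

Lemma wirt_wirtinger f v : wirt f v = wirtinger (- iC) f v.
Proof. by apply/funext => y; rewrite /wirt /wirtinger mulNr. Qed.

Lemma complex_split (a : C) :
  a = ((complex.Re a)%:C : C) + ((complex.Im a)%:C : C) * iC.
Proof. by case: a => x y; simpc. Qed.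

Section AtPoint.
Variables (U : set Cn) (z : Cn) (oU : open U) (Uz : U z).

Lemma rderive_i f (a : C) v : smooth_on U f ->
  rderive f (a *: v) z = ((complex.Re a)%:C : C) * rderive f v z +
   ((complex.Im a)%:C : C) * rderive f (iC *: v) z.
Proof.
move=> fs; rewrite -!(rderiveZv oU Uz _ _ fs) -(rderiveDv oU Uz _ _ fs).
by rewrite {1}(complex_split a) scalerDl -scalerA.
Qed.

Lemma wirtDv f u v : smooth_on U f -> wirt f (u + v) z = wirt f u z + wirt f v z.
Proof.
move=> fs; rewrite /wirt scalerDr (rderiveDv oU Uz u v fs).
by rewrite (rderiveDv oU Uz (iC *: u) (iC *: v) fs); exact: wirt_algD.
Qed.

(** The real derivatives are only real linear in the direction. Complex linearity comes from
    D_(i(iv)) = - D_v: replacing v by i v multiplies D_v - i D_(iv) by i. *)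
Lemma wirtZv f (a : C) v : smooth_on U f -> wirt f (a *: v) z = a * wirt f v z.
Proof.
move=> fs; have iav : iC *: (a *: v) = a *: (iC *: v) by rewrite !scalerA mulrC.
have iiv : iC *: (iC *: v) = ((-1 : R)%:C : C) *: v.
  by rewrite scalerA iCM; congr (_ *: _); rewrite raddfN.
have di : rderive f (iC *: (iC *: v)) z = - rderive f v z.
  by rewrite iiv (rderiveZv oU Uz (-1) v fs) raddfN mulN1r.
rewrite /wirt iav (rderive_i a v fs) (rderive_i a (iC *: v) fs) di.
rewrite [X in _ = X * _](complex_split a); exact: wirt_algZ iCM.
Qed.

Lemma wirt_sumv f (I : Type) (s : seq I) (a : I -> C) (v : I -> Cn) : smooth_on U f ->
  wirt f (\sum_(i <- s) a i *: v i) z = \sum_(i <- s) a i * wirt f (v i) z.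
Proof.
move=> fs; elim: s => [|i s IH].
  by rewrite !big_nil -(scale0r 0) wirtZv // mul0r.
by rewrite !big_cons wirtDv // wirtZv // IH.
Qed.

Lemma rderive_lin f (e : C) v w : smooth_on U f ->
  rderive (fun y => (rderive f v y + e * rderive f (iC *: v) y) / 2%:R) w z =
  (rderive (rderive f v) w z + e * rderive (rderive f (iC *: v)) w z) / 2%:R.
Proof.
move=> fs.
have r1 := smooth_on_rderivable w (smooth_on_rderive v fs) Uz.
have r2 := smooth_on_rderivable w (smooth_on_rderive (iC *: v) fs) Uz.
have [s1 s2] := rderivableZ e r2.
have [t1 t2] := rderivableD r1 s1.
rewrite -s2 -t2 [RHS]mulrC -(rderivableZ _ t1).2.
by congr (rderive _ w z); apply/funext => y; rewrite mulrC.
Qed.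

(** Both sides expand into second real derivatives, matched by symmetry for the four pairs formed
    from v, i v and w, i w. With [e] and [e'] independent, one proof covers both [wirtC] and
    [wirt_wirtbarC]. *)
Lemma wirtingerC f (e e' : C) v w : smooth_on U f ->
  wirtinger e (wirtinger e' f v) w z = wirtinger e' (wirtinger e f w) v z.
Proof.
move=> fs.
have E1 := rderive_lin e' v w fs; have E2 := rderive_lin e' v (iC *: w) fs.
have E3 := rderive_lin e w v fs; have E4 := rderive_lin e w (iC *: v) fs.
transitivity (
  ((rderive (rderive f v) w z + e' * rderive (rderive f (iC *: v)) w z) / 2%:R +
   e * ((rderive (rderive f v) (iC *: w) z +
         e' * rderive (rderive f (iC *: v)) (iC *: w) z) / 2%:R)) / 2%:R).
  exact: (congr2 (fun a b => (a + e * b) / 2%:R) E1 E2).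
apply: etrans _ (esym (congr2 (fun a b => (a + e' * b) / 2%:R) E3 E4)).
exact: (wirt_algC _ e e' (rderiveC oU Uz v w fs) (rderiveC oU Uz (iC *: v) w fs)
  (rderiveC oU Uz v (iC *: w) fs) (rderiveC oU Uz (iC *: v) (iC *: w) fs)).
Qed.

Lemma wirtC f v w : smooth_on U f -> wirt (wirt f v) w z = wirt (wirt f w) v z.
Proof.
move=> fs.
apply: etrans (congr1 (fun g => g z) (wirt_wirtinger (wirt f v) w)) _.
apply: etrans (congr1 (fun g => wirtinger (- iC) g w z) (wirt_wirtinger f v)) _.
apply: etrans _ (esym (congr1 (fun g => g z) (wirt_wirtinger (wirt f w) v))).
apply: etrans _ (esym (congr1 (fun g => wirtinger (- iC) g v z) (wirt_wirtinger f w))).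
exact: (wirtingerC (- iC) (- iC) v w fs).
Qed.

Lemma wirt_wirtbarC f v w : smooth_on U f ->
  wirt (wirtbar f v) w z = wirtbar (wirt f w) v z.
Proof.
move=> fs.
apply: etrans (congr1 (fun g => g z) (wirt_wirtinger (wirtbar f v) w)) _.
apply: etrans _ (esym (congr1 (fun g => wirtbar g v z) (wirt_wirtinger f w))).
exact: (wirtingerC (- iC) iC v w fs).
Qed.

End AtPoint.
End Wirtinger.

(** * Composition with holomorphic maps *)

Section Holomorphic.
Variables (R : realType) (n m : nat).
Local Notation C := (Cx R).
Local Notation Cn := 'rV[C]_n.
Implicit Types (v w z : Cn).
Local Notation iC := ('i%C : C).
Variables (V : set Cn) (oV : open V).
Variables (F : Cn -> 'rV[C]_m) (hF : holomorphic_on V F).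

(** The Cauchy-Riemann equation makes the real differential complex linear, so that it coincides
    with the Wirtinger derivative. *)
Lemma wirtbar0_rderive (f : Cn -> C) v z : wirtbar f v z = 0 ->
  rderive f (iC *: v) z = iC * wirt f v z /\ rderive f v z = wirt f v z.
Proof.
rewrite /wirtbar /wirt; set a := rderive f v z; set b := rderive _ _ _ => /eqP.
have n2 : (2%:R : C)^-1 != 0 by rewrite invr_eq0 pnatr_eq0.
rewrite mulf_eq0 (negPf n2) orbF addr_eq0 => /eqP ab.
have n2' : (2%:R : C) != 0 by rewrite pnatr_eq0.
have aE : a = (a - iC * b) / 2%:R.
  by rewrite -ab; apply: (mulIf n2'); rewrite divfK // mulr_natr mulr2n.
split; last exact: aE.
by rewrite -aE ab mulrN mulrA iCM mulN1r opprK.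
Qed.

Lemma jacobianC_wirt v z : V z ->
  v *m jacobianC F z = \row_j wirt (fun y => F y 0 j) v z.
Proof.
move=> Vz; apply/rowP => j; have [fs _] := hF j.
rewrite !mxE [in RHS](row_sum_delta v) (wirt_sumv oV Vz _ _ _ fs).
by apply: eq_bigr => i _; rewrite !mxE.
Qed.

(** As F is holomorphic, it sends the directions v and i v to d and i d with d = v J, so the two
    real derivatives of the composite recombine into a Wirtinger derivative of f. No [wirtbar] term
    of the merely smooth f appears. *)
Lemma is_wirt_comp (U : set 'rV[C]_m) (f : 'rV[C]_m -> C) v z :
  V z -> open U -> U (F z) -> smooth_on U f ->
  is_wirt (fun y => f (F y)) v z (wirt f (v *m jacobianC F z) (F z)).
Proof.
move=> Vz oU Uz fs; rewrite (jacobianC_wirt v Vz).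
set d := \row_j _.
have F0 w : F (z + ((0 : R)%:C : C) *: w) = F z by rewrite scale0r addr0.
have d1 j : cder (fun t : R => F (z + (t%:C : C) *: v) 0 j) (d 0 j).
  have [Fs /(_ z Vz v) /wirtbar0_rderive[_ e]] := hF j; rewrite mxE -e.
  exact/rderivableP/(smooth_on_rderivable v Fs Vz).
have d2 j : cder (fun t : R => F (z + (t%:C : C) *: (iC *: v)) 0 j) ((iC *: d) 0 j).
  have [Fs /(_ z Vz v) /wirtbar0_rderive[e _]] := hF j; rewrite mxE mxE -e.
  exact/rderivableP/(smooth_on_rderivable (iC *: v) Fs Vz).
have [r1 e1] := @cder_rderive R n (fun y => f (F y)) v z _ (rderive_comp oU Uz fs (F0 v) d1).
have [r2 e2] := @cder_rderive R n (fun y => f (F y)) (iC *: v) z _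
  (rderive_comp oU Uz fs (F0 (iC *: v)) d2).
by split; [exact: r1|exact: r2|rewrite /wirt e1 e2].
Qed.

Lemma is_wirt_mulmx_jacobianC k (A : 'M[C]_(k, n)) i j v z : V z ->
  is_wirt (fun y => (A *m jacobianC F y) i j) v z
    (wirt (wirt (fun y => F y 0 j) (row i A)) v z).
Proof.
move=> Vz; have [Fs _] := hF j.
apply: (is_wirt_near oV Vz _ (smooth_is_wirt v (smooth_on_wirt (row i A) oV Fs) Vz)).
move=> y Vy; have := congr1 (fun M : 'rV_m => M 0 j) (jacobianC_wirt (row i A) Vy).
by rewrite -row_mul !mxE.
Qed.

(** The entries of A J are Wirtinger derivatives of the components of F, hence again holomorphic
    since [wirt] and [wirtbar] commute; their conjugates are killed by [wirt]. For this reason the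
    arguments of type (0,1) bring no second derivatives into a pullback. *)
Lemma is_wirt_conj_mulmx_jacobianC k (A : 'M[C]_(k, n)) i j v z : V z ->
  is_wirt (fun y => Num.conj ((A *m jacobianC F y) i j)) v z 0.
Proof.
move=> Vz; have [Fs Fh] := hF j.
have ws := smooth_on_wirt (row i A) oV Fs.
have h := is_wirt_conj v ws Vz.
have w0 : wirtbar (wirt (fun y => F y 0 j) (row i A)) v z = 0.
  rewrite -(wirt_wirtbarC oV Vz v (row i A) Fs).
  apply: is_wirtE; apply: (is_wirt_near oV Vz _ (is_wirt_cst 0 (row i A) z)) => y Vy.
  by rewrite Fh.
rewrite w0 in h; rewrite -[X in is_wirt _ _ _ X](rmorph0 (@Num.conj C)).
apply: (is_wirt_near oV Vz _ h) => y Vy; congr Num.conj.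
have := congr1 (fun M : 'rV_m => M 0 j) (jacobianC_wirt (row i A) Vy).
by rewrite -row_mul !mxE.
Qed.
End Holomorphic.

(** * Alternating multilinear maps *)

Section Multilinear.
Variables (R : realType) (n : nat).
Local Notation C := (Cx R).
Local Notation Cn := 'rV[C]_n.

(** Replacing a row turns the condition on three matrices in [semi_multilinear] into an equation in
    that single row; [multilinearP] and [semi_multilinearI] pass between the two forms. *)
Definition replrow k (i : 'I_k) (A : 'M[C]_(k, n)) (u : Cn) : 'M[C]_(k, n) :=
  \matrix_(l, j) if l == i then u 0 j else A l j.

Lemma row_replrow k (i : 'I_k) (A : 'M[C]_(k, n)) (u : Cn) : row i (replrow i A u) = u.
Proof. by apply/rowP => j; rewrite !mxE eqxx. Qed.

Lemma row_replrow_neq k (i l : 'I_k) (A : 'M[C]_(k, n)) (u : Cn) :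
  l != i -> row l (replrow i A u) = row l A.
Proof. by move=> /negPf li; apply/rowP => j; rewrite !mxE li. Qed.

Lemma row'_replrow k (i : 'I_k) (A : 'M[C]_(k, n)) (u : Cn) :
  row' i (replrow i A u) = row' i A.
Proof. by apply/matrixP => l j; rewrite !mxE eq_sym (negPf (neq_lift i l)). Qed.

Lemma replrow_id k (i : 'I_k) (A : 'M[C]_(k, n)) : replrow i A (row i A) = A.
Proof. by apply/matrixP => l j; rewrite !mxE; case: eqP => // ->. Qed.

Lemma replrowC k (i l : 'I_k) (A : 'M[C]_(k, n)) u v : i != l ->
  replrow i (replrow l A u) v = replrow l (replrow i A v) u.
Proof.
move=> il; apply/matrixP => /= a b; rewrite !mxE; case: eqP => // ai.
by rewrite ai (negPf il).
Qed.

Lemma row_row' k (i : 'I_k.+1) (l : 'I_k) (A : 'M[C]_(k.+1, n)) :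
  row l (row' i A) = row (lift i l) A.
Proof. by apply/rowP => j; rewrite !mxE. Qed.

Lemma row'_replrow_lift k (i : 'I_k.+1) (l : 'I_k) (A : 'M[C]_(k.+1, n)) u :
  row' i (replrow (lift i l) A u) = replrow l (row' i A) u.
Proof. by apply/matrixP => /= a b; rewrite !mxE (inj_eq lift_inj). Qed.

Lemma row'_mulmx k m (i : 'I_k.+1) (A : 'M[C]_(k.+1, n)) (J : 'M[C]_(n, m)) :
  row' i (A *m J) = row' i A *m J.
Proof. by apply/matrixP => /= a b; rewrite !mxE; apply: eq_bigr => j _; rewrite !mxE. Qed.

Section Form.
Variables (sigma : C -> C) (sigma1 : sigma 1 = 1).
Variables (k : nat) (F : 'M[C]_(k, n) -> C) (Fm : semi_multilinear sigma F).

Lemma multilinearP (i : 'I_k) A (c : C) u v :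
  F (replrow i A (c *: u + v)) = sigma c * F (replrow i A u) + F (replrow i A v).
Proof. by apply: (Fm (i := i)); rewrite ?row_replrow // !row'_replrow. Qed.

Lemma multilinear0 (i : 'I_k) A : F (replrow i A 0) = 0.
Proof.
have := multilinearP i A 1 0 0.
rewrite scale1r addr0 sigma1 mul1r => /eqP.
by rewrite -[X in X == _]addr0 (inj_eq (addrI _)) eq_sym => /eqP.
Qed.

Lemma multilinearD (i : 'I_k) A u v :
  F (replrow i A (u + v)) = F (replrow i A u) + F (replrow i A v).
Proof. by rewrite -[u]scale1r multilinearP scale1r sigma1 mul1r. Qed.

Lemma multilinear_row (i : 'I_k) A u :
  F (replrow i A u) = \sum_j sigma (u 0 j) * F (replrow i A (delta_mx 0 j)).
Proof.
rewrite [in LHS](row_sum_delta u).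
elim: (index_enum _) => [|j s IH]; first by rewrite !big_nil multilinear0.
by rewrite !big_cons multilinearP IH.
Qed.

Lemma multilinear_expand_row (i : 'I_k) A :
  F A = \sum_j sigma (A i j) * F (replrow i A (delta_mx 0 j)).
Proof.
rewrite -{1}(replrow_id i A) multilinear_row.
by apply: eq_bigr => j _; rewrite mxE.
Qed.

Lemma multilinear_delta0 :
  (forall A, (forall i, exists j, row i A = delta_mx 0 j) -> F A = 0) ->
  forall A, F A = 0.
Proof.
move=> F0 A.
(* The list [s] holds the rows not yet known to be basis vectors; each step expands one of them. *)
suff H (s : seq 'I_k) : forall A,
    (forall i, i \notin s -> exists j, row i A = delta_mx 0 j) -> F A = 0.
  by apply: (H (enum 'I_k)) => i; rewrite mem_enum.
elim: s => [|i s IH] B Bs; first by apply: F0 => i; exact: Bs.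
rewrite (multilinear_expand_row i) big1 // => j _; rewrite IH ?mulr0 // => l ls.
have [->|li] := eqVneq l i; first by exists j; rewrite row_replrow.
have [|j' jE] := Bs l; first by rewrite inE negb_or li.
by exists j'; rewrite row_replrow_neq.
Qed.

Hypothesis Fa : Defs.alternating F.

Lemma alternating_swap (i j : 'I_k) A u v : i != j ->
  F (replrow i (replrow j A u) v) = - F (replrow i (replrow j A v) u).
Proof.
move=> ij; pose G a b := F (replrow i (replrow j A a) b).
have GG a : G a a = 0.
  apply: (Fa ij); rewrite row_replrow row_replrow_neq ?row_replrow //.
  by rewrite eq_sym.
have Gr a b c : G a (b + c) = G a b + G a c by exact: multilinearD.
have Gl a b c : G (a + b) c = G a c + G b c.
  by rewrite /G !(replrowC _ _ _ ij) multilinearD.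
have := GG (u + v); rewrite Gl !Gr !GG add0r addr0 => /eqP.
by rewrite addr_eq0 => /eqP.
Qed.

Lemma alternating_xrow (i j : 'I_k) A : i != j -> F (xrow i j A) = - F A.
Proof.
move=> ij; have -> : xrow i j A = replrow i (replrow j A (row i A)) (row j A).
  apply/matrixP => /= a b; rewrite !mxE.
  case: tpermP => [->|->|/eqP/negPf -> /eqP/negPf -> //]; rewrite eqxx //.
  by rewrite eq_sym (negPf ij).
rewrite alternating_swap // replrow_id; congr (- F _).
apply/matrixP => /= a b; rewrite !mxE.
by case: eqP => // ->.
Qed.

(** By multilinearity the rows may be taken among the n basis vectors, and k > n forces two of them
    to be equal. *)
Lemma alternating_large : (n < k)%N -> forall A, F A = 0.
Proof.
move=> nk; apply: multilinear_delta0 => A Ad.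
have [phi phiE] := choice Ad.
have /injectivePn[i [j ij phiij]] : ~~ injectiveb phi.
  apply/negP => /injectiveP /leq_card; rewrite !card_ord.
  by rewrite leqNgt nk.
by apply: (Fa ij); rewrite !phiE phiij.
Qed.

End Form.

(* The two minors differ by a cyclic permutation of the j - i - 1 rows between. *)
Lemma alternating_row' (sigma : C -> C) k (F : 'M[C]_(k, n) -> C) (i j : 'I_k.+1)
    (P : 'M[C]_(k.+1, n)) :
  sigma 1 = 1 -> semi_multilinear sigma F -> Defs.alternating F ->
  i != j -> row i P = row j P ->
  (-1) ^+ i * F (row' i P) + (-1) ^+ j * F (row' j P) = 0.
Proof.
move=> s1 Fm Fa.
have H d : forall (i j : 'I_k.+1) P, (j = i + d.+1 :> nat)%N -> row i P = row j P ->
    (-1) ^+ i * F (row' i P) + (-1) ^+ j * F (row' j P) = 0.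
  (* For adjacent equal rows the two minors are the same matrix and the signs are opposite. *)
  elim: d => [|d IH] {}i {}j {}P jid ijP.
    have -> : row' i P = row' j P.
      apply/matrixP => /= a b; rewrite !mxE.
      have [ai|ai] := eqVneq (a : nat) i.
        have -> : lift i a = j by apply: val_inj; rewrite /= /bump; lia.
        have -> : lift j a = i by apply: val_inj; rewrite /= /bump; lia.
        by have := congr1 (fun r : 'rV_n => r 0 b) ijP; rewrite !mxE.
      have -> // : lift i a = lift j a by apply: val_inj; rewrite /= /bump; lia.
    by rewrite jid addn1 exprS mulN1r mulNr addrN.
  have jk := ltn_ord j.
  have j'k : (i + d.+1 < k.+1)%N by lia.
  pose j' := Ordinal j'k.
  have ak : (i + d < k)%N by lia.
  have bk : (i + d.+1 < k)%N by lia.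
  (* Exchanging the rows j - 1 and j brings the repeated row one step closer to i. The minor at i
     changes sign, the minor at j - 1 becomes that of P at j, and (-1)^j = - (-1)^(j-1) restores the
     relation. *)
  have := IH i j' (xrow j' j P) erefl.
  have -> : row i (xrow j' j P) = row j' (xrow j' j P).
    rewrite /xrow; apply/rowP => b; rewrite !mxE tpermL tpermD.
    - by have := congr1 (fun r : 'rV_n => r 0 b) ijP; rewrite !mxE.
    - by apply/eqP => /(congr1 val) /=; lia.
    - by apply/eqP => /(congr1 val) /=; lia.
  move=> /(_ erefl).
  have -> : row' i (xrow j' j P) = xrow (Ordinal ak) (Ordinal bk) (row' i P).
    have aj : lift i (Ordinal ak) = j' by apply: val_inj; rewrite /= /bump; lia.
    have bj : lift i (Ordinal bk) = j by apply: val_inj; rewrite /= /bump; lia.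
    apply/matrixP => /= a b; rewrite !mxE -aj -bj.
    case: tpermP => [/lift_inj->|/lift_inj->|]; rewrite ?tpermL ?tpermR //.
    move=> /eqP; rewrite (inj_eq lift_inj) => /eqP a1 /eqP.
    rewrite (inj_eq lift_inj) => /eqP a2.
    by rewrite tpermD // eq_sym; apply/eqP.
  have -> : row' j' (xrow j' j P) = row' j P.
    apply/matrixP => /= a b; rewrite !mxE; case: tpermP => [aj|aj|aj aj'].
    - by move: (neq_lift j' a); rewrite aj eqxx.
    - congr (P _ _); apply: val_inj; rewrite /= /bump.
      by move: (congr1 val aj); rewrite /= /bump; lia.
    - congr (P _ _); apply: val_inj; rewrite /= /bump.
      have : lift j' a <> j :> nat by move=> /val_inj.
      by rewrite /= /bump; lia.
  rewrite (alternating_xrow s1 Fm Fa); last by apply/eqP => /(congr1 val) /=; lia.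
  have -> : (j = (val j').+1 :> nat)%N by rewrite jid /=; lia.
  rewrite exprS mulN1r mulrN mulNr => /eqP; rewrite addrC subr_eq0 => /eqP ->.
  by rewrite subrr.
move=> ij rij; case: (ltngtP i j) => [lt|lt|/val_inj e].
- by apply: (H (j - i.+1)%N) => //; lia.
- by rewrite addrC; apply: (H (i - j.+1)%N) => //; lia.
- by rewrite e eqxx in ij.
Qed.

End Multilinear.

(** * Differentiating a multilinear map with moving arguments *)

Section MultilinearDerivative.
Variables (R : realType) (n : nat).
Local Notation C := (Cx R).
Local Notation Cn := 'rV[C]_n.

Lemma semi_multilinearI (sigma : C -> C) k (F : 'M[C]_(k, n) -> C) :
  (forall (i : 'I_k) A c u v, F (replrow i A (c *: u + v)) =
     sigma c * F (replrow i A u) + F (replrow i A v)) ->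
  semi_multilinear sigma F.
Proof.
move=> H i A A1 A2 c rA r1 r2.
have E (B : 'M[C]_(k, n)) : row' i A = row' i B -> B = replrow i A (row i B).
  move=> AB; apply/matrixP => l j; rewrite !mxE; case: eqP => [-> //|/eqP li].
  have [l' ->|] := unliftP i l; last by move=> e; rewrite e eqxx in li.
  by have := congr1 (fun M : 'M[C]_(_, _) => M l' j) AB; rewrite !mxE.
by rewrite (E A1 r1) (E A2 r2) -H -rA replrow_id.
Qed.

Section Derivative.
Variables (sigma : C -> C) (sigma0 : sigma 0 = 0) (sigma1 : sigma 1 = 1).
Variables (U : set Cn) (z v : Cn) (oU : open U) (Uz : U z).
Variables (k : nat) (f : Cn -> 'M[C]_(k, n) -> C) (D : 'M[C]_(k, n) -> C).
Hypothesis fm : forall y, U y -> semi_multilinear sigma (f y).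
Hypothesis fD : forall E, is_wirt (fun y => f y E) v z (D E).

Let D_row (i : 'I_k) (A : 'M[C]_(k, n)) :
  \sum_j sigma (A i j) * D (replrow i A (delta_mx 0 j)) = D A.
Proof.
rewrite -(is_wirtE (fD A)); apply/esym/is_wirtE.
apply: (is_wirt_near oU Uz _ (is_wirt_sum (index_enum _)
  (fun j => is_wirtZ (sigma (A i j)) (fD (replrow i A (delta_mx 0 j)))))) => y Uy.
by rewrite -(multilinear_expand_row sigma1 (fm Uy) i A).
Qed.

(* Induction on the list of the rows of M that are allowed to vary. *)
Lemma is_wirt_multilinear (M : Cn -> 'M[C]_(k, n)) (dM : 'M[C]_(k, n)) :
  (forall i j, is_wirt (fun y => sigma (M y i j)) v z (sigma (dM i j))) ->
  is_wirt (fun y => f y (M y)) v z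
    (D (M z) + \sum_i f z (replrow i (M z) (row i dM))).
Proof.
suff H (s : seq 'I_k) : forall (M : Cn -> 'M[C]_(k, n)) (dM : 'M[C]_(k, n)),
    (forall i j, is_wirt (fun y => sigma (M y i j)) v z (sigma (dM i j))) ->
    (forall i, i \notin s -> (forall y, row i (M y) = row i (M z)) /\ row i dM = 0) ->
    is_wirt (fun y => f y (M y)) v z
      (D (M z) + \sum_i f z (replrow i (M z) (row i dM))).
  by move=> Md; apply: (H (enum 'I_k)) => // i; rewrite mem_enum.
elim: s => [|i s IH] {}M {}dM Md Ms.
  rewrite big1 ?addr0 => [|i _].
    rewrite (_ : (fun y => f y (M y)) = (fun y => f y (M z))); first exact: fD.
    apply/funext => y; congr f; apply/row_matrixP => i.
    by have [] := Ms i isT.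
  by have [_ ->] := Ms i isT; exact: (multilinear0 sigma1 (fm Uz) i (M z)).
(* Expansion along row i: [f y (M y)] is the sum over j of [sigma (M y i j) * f y (N j y)]. Row i of
   [N j] is the constant e_j, hence the zero row in [dN], and the induction hypothesis applies to
   each [N j]. *)
pose N j y := replrow i (M y) (delta_mx 0 j : Cn).
pose dN := replrow i dM (0 : Cn).
have HN j : is_wirt (fun y => f y (N j y)) v z
    (D (N j z) + \sum_l f z (replrow l (N j z) (row l dN))).
  apply: IH => [l b|l ls].
    have [li|li] := eqVneq l i.
      rewrite (_ : (fun y => _) = (fun=> sigma ((delta_mx 0 j : Cn) 0 b))); last first.
        by apply/funext => y; rewrite mxE li eqxx.
      have -> : dN l b = 0 by rewrite !mxE li eqxx.
      by rewrite sigma0; exact: is_wirt_cst.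
    rewrite (_ : (fun y => _) = (fun y => sigma (M y l b))); last first.
      by apply/funext => y; rewrite mxE (negPf li).
    by rewrite mxE (negPf li); exact: Md.
  have [->|li] := eqVneq l i; first by split=> [y|]; rewrite /N /dN !row_replrow.
  have [|h1 h2] := Ms l; first by rewrite inE negb_or li.
  by split=> [y|]; rewrite !row_replrow_neq.
have := is_wirt_near oU Uz _ (is_wirt_sum (index_enum _) (fun j => is_wirtM (Md i j) (HN j))).
move=> /(_ (fun y => f y (M y)))[y Uy|].
  by rewrite -(multilinear_expand_row sigma1 (fm Uy) i).
move=> h1 h2 e; split=> //; rewrite e big_split /=.
under [X in _ + X]eq_bigr do rewrite mulrDr.
rewrite big_split /= D_row addrCA; congr (_ + _).
rewrite [RHS](bigD1 i) //=; congr (_ + _).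
  rewrite (multilinear_row sigma1 (fm Uz)).
  by apply: eq_bigr => j _; rewrite mxE.
under eq_bigr do rewrite mulr_sumr.
rewrite exchange_big (bigD1 i) //= big1 ?add0r.
  apply: eq_bigr => l li.
  rewrite [RHS](multilinear_expand_row sigma1 (fm Uz) i).
  apply: eq_bigr => j _; rewrite mxE eq_sym (negPf li) row_replrow_neq //.
  by rewrite /N replrowC.
move=> j _; rewrite row_replrow; have -> := multilinear0 sigma1 (fm Uz) i (N j z).
by rewrite mulr0.
Qed.

End Derivative.

Lemma sum_lift (V : zmodType) k (i : 'I_k.+1) (G : 'I_k.+1 -> V) :
  \sum_l G (lift i l) = \sum_(m | m != i) G m.
Proof.
apply: (addrI (G i)); transitivity (\sum_m G m); last by rewrite (bigD1 i).
by rewrite (bigD1_ord i).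
Qed.

(* The terms of the double sum are indexed by the pairs (i, m) with m != i. *)
Lemma sum_antisym (k : nat) (G : 'I_k.+1 -> 'I_k.+1 -> C) :
  (forall i m, m != i -> G i m = - G m i) -> \sum_i \sum_l G i (lift i l) = 0.
Proof.
move=> Ga; under eq_bigr do rewrite sum_lift.
set X := LHS; have XN : X = - X.
  rewrite {1}/X (exchange_big_dep predT) //= -sumrN; apply: eq_bigr => m _.
  rewrite -sumrN; apply: eq_big => [i|i im]; first by rewrite eq_sym.
  exact: Ga.
apply/eqP; have := XN => /eqP; rewrite -addr_eq0 -mulr2n -mulr_natr mulf_eq0.
by rewrite pnatr_eq0 orbF.
Qed.
End MultilinearDerivative.

(** * The operators on forms *)

Section Forms.
Variables (R : realType) (n : nat) (X : complex_manifold R n).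
Local Notation C := (Cx R).
Local Notation Cn := 'rV[C]_n.
Local Notation img a := (chart_img (cm_chart (c:=X) a)).

Lemma wirt_lin (U : set Cn) (f g h : Cn -> C) (c : C) (v z : Cn) :
  open U -> U z -> (forall y, U y -> f y = c * g y + h y) ->
  smooth_on U g -> smooth_on U h -> wirt f v z = c * wirt g v z + wirt h v z.
Proof.
move=> oU Uz fE gs hs; apply: is_wirtE.
have gh := is_wirtD (is_wirtZ c (smooth_is_wirt v gs Uz)) (smooth_is_wirt v hs Uz).
by apply: (is_wirt_near oU Uz _ gh) => y Uy; rewrite fE.
Qed.

Lemma wirt0 (U : set Cn) (f : Cn -> C) (v z : Cn) :
  open U -> U z -> (forall y, U y -> f y = 0) -> wirt f v z = 0.
Proof.
move=> oU Uz f0; apply: is_wirtE.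
by apply: (is_wirt_near oU Uz _ (is_wirt_cst 0 v z)) => y Uy; rewrite f0.
Qed.

Section Del.
Variables (r s : nat) (w : local_forms X r s) (wf : forms w).

Lemma img_open a : open (img a).
Proof. exact: chart_img_open. Qed.

Lemma form_smooth a A B : smooth_on (img a) (fun x => w a x A B).
Proof. by case: wf => _ H _; exact: H. Qed.

Lemma form_linA a z B : img a z -> semi_multilinear id (fun A => w a z A B).
Proof. by case: wf => H _ _ /H[/(_ B)[]]. Qed.

Lemma form_altA a z B : img a z -> Defs.alternating (fun A => w a z A B).
Proof. by case: wf => H _ _ /H[/(_ B)[]]. Qed.

Lemma form_linB a z A : img a z -> semi_multilinear (fun c : C => Num.conj c) (w a z A).
Proof. by case: wf => H _ _ /H[_ /(_ A)[]]. Qed.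

Lemma form_altB a z A : img a z -> Defs.alternating (w a z A).
Proof. by case: wf => H _ _ /H[_ /(_ A)[]]. Qed.

Let conj1 : (fun c : C => Num.conj c) 1 = 1.
Proof. exact: rmorph1. Qed.

Let conj0 : (fun c : C => Num.conj c) 0 = 0.
Proof. exact: rmorph0. Qed.

(** In the k-th term, row i is the direction of differentiation if k = i and an argument of w
    otherwise; linearity comes from [wirtDv] and [wirtZv] in one case, from w in the other. *)
Lemma del_linA a z B : img a z -> semi_multilinear id (fun A => del w a z A B).
Proof.
move=> az; apply: semi_multilinearI => i A c u v.
rewrite /del mulr_sumr -big_split /=; apply: eq_bigr => k _.
have [->|ki] := eqVneq k i.
  rewrite !row'_replrow !row_replrow.
  have fs := form_smooth a (row' i A) B.
  rewrite (wirtDv (img_open (a := a)) az _ _ fs) (wirtZv (img_open (a := a)) az _ _ fs).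
  by rewrite mulrDr mulrCA.
rewrite !row_replrow_neq //.
have [l iE|e] := unliftP k i; last by rewrite e eqxx in ki.
rewrite iE !row'_replrow_lift.
rewrite (@wirt_lin (img a) _ (fun x => w a x (replrow l (row' k A) u) B)
   (fun x => w a x (replrow l (row' k A) v) B) c (row k A) z (img_open (a := a)) az).
- by rewrite mulrDr mulrCA.
- by move=> y ay; exact: (multilinearP (form_linA B ay)).
- exact: form_smooth.
- exact: form_smooth.
Qed.

(** Terms that differentiate along any other row keep both equal rows as arguments and vanish. The
    terms of i and j are derivatives along the same vector, so they combine into the derivative of a
    signed sum of two minors that is identically zero. *)
Lemma del_altA a z B : img a z -> Defs.alternating (fun A => del w a z A B).
Proof.
move=> az i j A ij rij; rewrite /del (bigD1 i) //= (bigD1 j) 1?eq_sym //= addrA.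
rewrite [X in _ + X]big1 ?addr0 => [|k /andP[ki kj]].
  rewrite -rij.
  have wE := is_wirtD
    (is_wirtZ ((-1) ^+ i) (smooth_is_wirt (row i A) (form_smooth a (row' i A) B) az))
    (is_wirtZ ((-1) ^+ j) (smooth_is_wirt (row i A) (form_smooth a (row' j A) B) az)).
  rewrite -(is_wirtE wE); apply: (@wirt0 (img a) _ (row i A) z (img_open (a := a)) az).
  move=> y ay.
  exact: (alternating_row' (sigma := id) erefl (form_linA B ay) (form_altA B ay) ij rij).
rewrite (@wirt0 (img a) _ (row k A) z (img_open (a := a)) az) ?mulr0 // => y ay.
have [i' iE|e] := unliftP k i; last by rewrite e eqxx in ki.
have [j' jE|e] := unliftP k j; last by rewrite e eqxx in kj.
apply: (form_altA B ay (i := i') (j := j')).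
  by apply: contraNneq ij => ij'; rewrite iE jE ij'.
by rewrite !row_row' -iE -jE.
Qed.

Lemma del_linB a z A : img a z ->
  semi_multilinear (fun c : C => Num.conj c) (del w a z A).
Proof.
move=> az; apply: semi_multilinearI => i B c u v.
rewrite /del mulr_sumr -big_split /=; apply: eq_bigr => k _.
rewrite (@wirt_lin (img a) _ (fun x => w a x (row' k A) (replrow i B u))
   (fun x => w a x (row' k A) (replrow i B v)) (Num.conj c) (row k A) z (img_open (a := a)) az).
- by rewrite mulrDr mulrCA.
- by move=> y ay; exact: (multilinearP (form_linB (row' k A) ay)).
- exact: form_smooth.
- exact: form_smooth.
Qed.

Lemma del_altB a z A : img a z -> Defs.alternating (del w a z A).
Proof.
move=> az i j B ij rij; rewrite /del big1 // => k _.
rewrite (@wirt0 (img a) _ (row k A) z (img_open (a := a)) az) ?mulr0 // => y ay.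
exact: (form_altB (row' k A) ay ij rij).
Qed.

Lemma del_smooth a A B : smooth_on (img a) (fun z => del w a z A B).
Proof.
apply: smooth_on_sum => [|i]; first exact: img_open.
apply: smooth_onZ; first exact: img_open.
by apply: smooth_on_wirt; [exact: img_open|exact: form_smooth].
Qed.

(** [chart_inv] is continuous only on the image of its chart, so the preimage of a domain is open
    relative to that image, which is itself open. *)
Lemma overlap_open a b : open (overlap (cm_chart (c:=X) a) (cm_chart b)).
Proof.
have /continuousP ci := chart_inv_cont (c := cm_chart (c:=X) a).
have := ci _ (chart_dom_open (cm_chart (c:=X) b)).
move=> /open_subspaceP[V oV VE].
rewrite (_ : overlap _ _ = V `&` img a); first by apply: openI => //; exact: img_open.
by rewrite VE; apply/seteqP; split=> x /= [].
Qed.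

(** * Invariance of d under a change of charts *)

Section Transition.
Variables (a b : cm_index X) (z : Cn).
Local Notation O := (overlap (cm_chart (c:=X) a) (cm_chart b)).
Local Notation t := (transition (cm_chart (c:=X) a) (cm_chart b)).
Local Notation J := (jacobianC t).
Hypothesis Oz : O z.

Let oO : open O. Proof. exact: overlap_open. Qed.

Let ht : holomorphic_on O t. Proof. exact: cm_holomorphic. Qed.

Let img_t y : O y -> img b (t y).
Proof. by case=> _; exact: chart_map_in. Qed.

(* Second derivative of the change of charts, as a vector-valued bilinear form. *)
Definition hess (u v : Cn) : Cn := \row_j wirt (wirt (fun y => t y 0 j) v) u z.

Lemma hessE u v j : hess u v 0 j = wirt (wirt (fun y => t y 0 j) v) u z.
Proof. by rewrite /hess [LHS]mxE. Qed.

Let hessC u v : hess u v = hess v u.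
Proof.
apply/rowP => j; have [ts _] := ht j.
exact: etrans (hessE u v j) (etrans (wirtC oO Oz v u ts) (esym (hessE v u j))).
Qed.

(** The product rule is applied first in the (0,1)-arguments, whose conjugated Jacobian has zero
    derivative, then in the (1,0)-arguments, each of which yields one Hessian term. *)
Lemma is_wirt_pullback (A : 'M[C]_(r, n)) (B : 'M[C]_(s, n)) v :
  is_wirt (fun y => w b (t y) (A *m J y) (B *m J y)) v z
    (wirt (fun x => w b x (A *m J z) (B *m J z)) (v *m J z) (t z) +
     \sum_l w b (t z) (replrow l (A *m J z) (hess v (row l A))) (B *m J z)).
Proof.
have fB E : is_wirt (fun y => w b (t y) E (B *m J y)) v z
    (wirt (fun x => w b x E (B *m J z)) (v *m J z) (t z)).
  have := @is_wirt_multilinear R n (fun c : C => Num.conj c) conj0 conj1 O z v oO Oz s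
    (fun y => w b (t y) E) (fun G => wirt (fun x => w b x E G) (v *m J z) (t z))
    (fun y Oy => form_linB E (img_t Oy))
    (fun G => is_wirt_comp oO ht v Oz (img_open (a := b)) (img_t Oz) (form_smooth b E G))
    (fun y => B *m J y) 0.
  have zE i j : is_wirt (fun y => Num.conj ((B *m J y) i j)) v z
      (Num.conj ((0 : 'M[C]_(s, n)) i j)).
    by rewrite mxE rmorph0; exact: (is_wirt_conj_mulmx_jacobianC oO ht B i j v Oz).
  move=> /(_ zE); rewrite big1 ?addr0 // => i _; rewrite row0.
  exact: (multilinear0 conj1 (form_linB E (img_t Oz)) i (B *m J z)).
have := @is_wirt_multilinear R n id erefl erefl O z v oO Oz r
    (fun y E => w b (t y) E (B *m J y))
    (fun E => wirt (fun x => w b x E (B *m J z)) (v *m J z) (t z))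
    (fun y Oy => form_linA (B *m J y) (img_t Oy)) fB
    (fun y => A *m J y) (\matrix_l hess v (row l A)).
have zE i j : is_wirt (fun y => (A *m J y) i j) v z ((\matrix_l hess v (row l A)) i j).
  have -> : (\matrix_l hess v (row l A)) i j = hess v (row i A) 0 j.
    by rewrite -[in RHS](rowK (fun l => hess v (row l A)) i) [RHS]mxE.
  by rewrite hessE; exact: (is_wirt_mulmx_jacobianC oO ht A i j v Oz).
move=> /(_ zE); congr is_wirt.
by congr (_ + _); apply: eq_bigr => l _; rewrite rowK.
Qed.

Lemma del_transition (A : 'M[C]_(r.+1, n)) (B : 'M[C]_(s, n)) :
  del w a z A B = del w b (t z) (A *m J z) (B *m J z).
Proof.
pose F (E : 'M[C]_(r, n)) := w b (t z) E (B *m J z).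
pose G (i m : 'I_r.+1) : C :=
  (-1) ^+ i * F (row' i (replrow m (A *m J z) (hess (row i A) (row m A)))).
have sumG : \sum_i \sum_l G i (lift i l) = 0.
  apply: sum_antisym => i m mi; apply/eqP; rewrite -addr_eq0; apply/eqP.
  rewrite /G (hessC (row m A)); set S := hess _ _.
  (* By symmetry of the Hessian the terms of (i, m) and (m, i) both carry the vector [S]. They are
     the signed minors of one matrix [P] with [S] in rows i and m, hence opposite. *)
  pose P := replrow i (replrow m (A *m J z) S) S.
  have -> : row' i (replrow m (A *m J z) S) = row' i P by rewrite row'_replrow.
  have -> : row' m (replrow i (A *m J z) S) = row' m P.
    by rewrite /P replrowC 1?eq_sym // row'_replrow.
  have im : i != m by rewrite eq_sym.
  have rP : row i P = row m P.
    by rewrite row_replrow row_replrow_neq // row_replrow.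
  exact: (alternating_row' (sigma := id) erefl (form_linA (B *m J z) (img_t Oz))
            (form_altA (B *m J z) (img_t Oz)) im rP).
transitivity (del w b (t z) (A *m J z) (B *m J z) + \sum_i \sum_l G i (lift i l)); last first.
  by rewrite sumG addr0.
rewrite /del -big_split /=; apply: eq_bigr => i _.
have h := is_wirt_pullback (row' i A) B (row i A).
have wE y : O y -> w b (t y) (row' i A *m J y) (B *m J y) = w a y (row' i A) B.
  by case: wf => _ _ H Oy; exact: (esym (H a b y Oy (row' i A) B)).
rewrite (is_wirtE (is_wirt_near oO Oz wE h)) mulrDr row_mul row'_mulmx mulr_sumr.
congr (_ + _); apply: eq_bigr => l _.
by rewrite /G /F row'_replrow_lift row'_mulmx row_row'.
Qed.

End Transition.

Lemma forms_del : forms (del w).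
Proof.
split=> [a z az|a A B|a b z Oz A B].
- split=> [B|A]; split; [exact: del_linA|exact: del_altA|exact: del_linB|exact: del_altB].
- exact: del_smooth.
- exact: del_transition.
Qed.

End Del.
End Forms.

(** * Linearity, conjugation and the relation d d = 0 *)

Section DolbeaultComplex.
Variables (R : realType) (n : nat) (X : complex_manifold R n).
Local Notation C := (Cx R).
Local Notation Cn := 'rV[C]_n.
Local Notation img a := (chart_img (cm_chart (c:=X) a)).
Local Notation "w1 ~~ w2" := (eq_forms w1 w2) (at level 70).

(** One operation provides scalar multiples, with [w2] zero, and differences, with [c = -1]. *)
Definition lin_form r s (c : C) (w1 w2 : local_forms X r s) : local_forms X r s :=
  fun a z A B => c * w1 a z A B + w2 a z A B.

Definition conj_form r s (w : local_forms X r s) : local_forms X s r :=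
  fun a z A B => Num.conj (w a z B A).

Local Notation null := (@zero_form R n X _ _).
Local Notation scale c w := (lin_form c w null).

Section Equivalence.
Variables (r s : nat).
Implicit Types w : local_forms X r s.

Lemma eq_forms_sym w1 w2 : w1 ~~ w2 -> w2 ~~ w1.
Proof. by move=> e a z az A B; rewrite e. Qed.

Lemma eq_forms_trans w1 w2 w3 : w1 ~~ w2 -> w2 ~~ w3 -> w1 ~~ w3.
Proof. by move=> e1 e2 a z az A B; rewrite e1 ?e2. Qed.

(** All the conditions on a form bear on its values over the chart images, transitions mapping
    overlaps into the image of the second chart. *)
Lemma forms_eq w1 w2 : w1 ~~ w2 -> forms w1 -> forms w2.
Proof.
move=> e [wm ws wt]; split=> [a z az|a A B|a b z Oz A B].
- have EA B : (fun A => w2 a z A B) = (fun A => w1 a z A B).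
    by apply/funext => A; rewrite e.
  have EB A : w2 a z A = w1 a z A by apply/funext => B; rewrite e.
  have [h1 h2] := wm a z az.
  by split=> [B|A]; [rewrite EA; exact: h1|rewrite EB; exact: h2].
- apply: smooth_on_eq (ws a A B); first exact: img_open.
  by move=> y ay; exact: e.
- case: (Oz) => az bz; have := wt a b z Oz A B => /= h.
  by rewrite -(e a z az) h; apply: e; exact: chart_map_in.
Qed.

Lemma forms_lin (c : C) w1 w2 : forms w1 -> forms w2 -> forms (lin_form c w1 w2).
Proof.
move=> f1 f2; split=> [a z az|a A B|a b z Oz A B].
- split=> [B|A]; split.
  + move=> i A A1 A2 d e1 e2 e3; rewrite /lin_form (form_linA f1 B az e1 e2 e3).
    by rewrite (form_linA f2 B az e1 e2 e3); ring.
  + move=> i j A ij e; rewrite /lin_form (form_altA f1 B az ij e) (form_altA f2 B az ij e).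
    by rewrite mulr0 addr0.
  + move=> i B B1 B2 d e1 e2 e3; rewrite /lin_form (form_linB f1 A az e1 e2 e3).
    by rewrite (form_linB f2 A az e1 e2 e3); ring.
  + move=> i j B ij e; rewrite /lin_form (form_altB f1 A az ij e) (form_altB f2 A az ij e).
    by rewrite mulr0 addr0.
- have oa := img_open (X := X) (a := a).
  exact: (smooth_onD oa (smooth_onZ c oa (form_smooth f1 a A B)) (form_smooth f2 a A B)).
- case: f1 f2 => _ _ t1 [_ _ t2].
  by have := t1 a b z Oz A B; have := t2 a b z Oz A B; rewrite /lin_form /= => -> ->.
Qed.

Lemma forms_zero : forms (null : local_forms X r s).
Proof.
split=> [a z az|a A B|a b z Oz A B] //.
- by split=> [B|A]; split=> // i A0 A1 A2 d _ _ _; rewrite /zero_form mulr0 addr0.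
- by apply: smooth_on_cst; exact: img_open.
Qed.

Lemma forms_scale (c : C) w : forms w -> forms (scale c w).
Proof. by move=> f; exact: forms_lin f forms_zero. Qed.

Lemma del_eq w1 w2 : forms w1 -> w1 ~~ w2 -> del w1 ~~ del w2.
Proof.
move=> f1 e a z az A B; apply: eq_bigr => i _; congr (_ * _).
apply/esym/(wirt_near _ (img_open (a := a)) az _ (form_smooth f1 a _ _)).
by move=> y ay; exact: e.
Qed.

Lemma del_lin (c : C) w1 w2 : forms w1 -> forms w2 ->
  del (lin_form c w1 w2) ~~ lin_form c (del w1) (del w2).
Proof.
move=> f1 f2 a z az A B; rewrite /lin_form /del mulr_sumr -big_split /=.
apply: eq_bigr => i _; rewrite (mulrCA c) -mulrDr; congr (_ * _).
apply: (wirt_lin _ (img_open (a := a)) az) => //; exact: form_smooth.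
Qed.

Lemma del_zero : del (null : local_forms X r s) ~~ null.
Proof.
move=> a z az A B; rewrite /del big1 // => i _.
by rewrite (wirt0 _ (img_open (a := a)) az) ?mulr0.
Qed.

Lemma forms_conj w : forms w -> forms (conj_form w).
Proof.
move=> f; split=> [a z az|a A B|a b z Oz A B].
- split=> [B|A]; split.
  + move=> i A A1 A2 d e1 e2 e3; rewrite /conj_form (form_linB f B az e1 e2 e3).
    by rewrite rmorphD rmorphM /= conjCK.
  + move=> i j A ij e; rewrite /conj_form (form_altB f B az ij e).
    exact: rmorph0.
  + move=> i B B1 B2 d e1 e2 e3; rewrite /conj_form (form_linA f A az e1 e2 e3).
    by rewrite rmorphD rmorphM.
  + move=> i j B ij e; rewrite /conj_form (form_altA f A az ij e).
    exact: rmorph0.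
- exact: (smooth_on_conj (img_open (a := a)) (form_smooth f a B A)).
- by case: f => _ _ t1; have := t1 a b z Oz B A => /= e; rewrite /conj_form e.
Qed.

(** The sign arises because [delbar] places its new vector after the r vectors of type (1,0),
    whereas [del] of the conjugate places it first. The properties of [del] are carried over to
    [delbar] by this relation. *)
Lemma delbar_conj w : forms w ->
  delbar w ~~ scale ((-1) ^+ r) (conj_form (del (conj_form w))).
Proof.
move=> f a z az A B; rewrite /lin_form /zero_form addr0 /delbar; congr (_ * _).
rewrite /conj_form /del rmorph_sum; apply: eq_bigr => j _.
rewrite rmorphM rmorphXn rmorphN1 /=; congr (_ * _).
by rewrite (wirt_conj _ (form_smooth f a A (row' j B)) az) conjCK.
Qed.

End Equivalence.

Lemma conj_formK r s (w : local_forms X r s) : conj_form (conj_form w) = w.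
Proof.
apply/funext => a; apply/funext => z; apply/funext => A; apply/funext => B.
exact: conjCK.
Qed.

Lemma conj_form_eq r s (w1 w2 : local_forms X r s) :
  w1 ~~ w2 -> conj_form w1 ~~ conj_form w2.
Proof. by move=> e a z az A B; rewrite /conj_form e. Qed.

Lemma conj_form_zero r s : conj_form (null : local_forms X r s) ~~ null.
Proof. move=> a z az A B; exact: rmorph0. Qed.

Lemma scale_eq0 r s (c : C) (w : local_forms X r s) : w ~~ null -> scale c w ~~ null.
Proof. by move=> e a z az A B; rewrite /lin_form e // /zero_form mulr0 addr0. Qed.

Lemma del_eq0 r s (w : local_forms X r s) : forms w -> w ~~ null -> del w ~~ null.
Proof. by move=> f e; apply: eq_forms_trans (del_eq f e) (@del_zero r s). Qed.

Lemma del_scale r s (c : C) (w : local_forms X r s) : forms w ->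
  del (scale c w) ~~ scale c (del w).
Proof.
move=> f; apply: eq_forms_trans (del_lin c f (@forms_zero r s)) _ => a z az A B.
by rewrite /lin_form (@del_zero r s a z az A B).
Qed.

Lemma forms_delbar r s (w : local_forms X r s) : forms w -> forms (delbar w).
Proof.
move=> f; apply: forms_eq (eq_forms_sym (delbar_conj f)) _.
exact: forms_scale (forms_conj (forms_del (forms_conj f))).
Qed.

(** Rows i and m can be deleted in either order, [a] and [b] being the position of the second one
    after the first is gone. The remaining rows agree, and the parities differ because exactly one
    of the two positions is shifted. *)
Lemma unbump_pair (i m a b : nat) : m = bump i a -> i = bump m b ->
  (forall c, bump i (bump a c) = bump m (bump b c)) /\ odd (i + a) = ~~ odd (m + b).
Proof. by rewrite /bump => e1 e2; split=> [c|]; rewrite ?/bump; lia. Qed.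

Lemma del_del r s (w : local_forms X r s) : forms w -> del (del w) ~~ null.
Proof.
move=> f a z az A B.
have oa := img_open (X := X) (a := a).
pose D (u v : Cn) (E : 'M[C]_(r, n)) := wirt (wirt (fun x => w a x E B) v) u z.
have DC u v E : D u v E = D v u E by exact: (wirtC oa az v u (form_smooth f a E B)).
(* The value 0 is taken only for m = i, an index that [lift i] never reaches. *)
pose G (i m : 'I_r.+2) : C := if unlift i m is Some l then
  (-1) ^+ i * ((-1) ^+ l * D (row i A) (row m A) (row' l (row' i A))) else 0.
transitivity (\sum_i \sum_l G i (lift i l)).
  apply: eq_bigr => i _.
  have h := is_wirt_sum (index_enum _) (fun l : 'I_r.+1 => is_wirtZ ((-1) ^+ l)
    (smooth_is_wirt (row i A) (smooth_on_wirt (row l (row' i A)) oa (form_smooth f a (row' l (row' i A)) B)) az)).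
  rewrite (is_wirtE h) mulr_sumr; apply: eq_bigr => l _.
  by rewrite /G liftK row_row'.
apply: sum_antisym => i m mi; rewrite /G.
have [l mE|e] := unliftP i m; last by rewrite e eqxx in mi.
have [l' iE|e] := unliftP m i; last by rewrite e eqxx in mi.
have [bb oo] := unbump_pair (congr1 val mE) (congr1 val iE).
have -> : row' l (row' i A) = row' l' (row' m A).
  apply/matrixP => c j; rewrite !mxE; congr (A _ j).
  by apply: val_inj; exact: bb.
rewrite (DC (row m A)); move: (D _ _ _) => d.
rewrite !mulrA -!exprD -mulNr; congr (_ * _).
by rewrite -signr_odd oo signrN signr_odd.
Qed.

End DolbeaultComplex.

(** * From Dolbeault to Bott-Chern cohomology *)

Section BottChern.
Variables (R : realType) (n : nat) (X : complex_manifold R n).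
Local Notation C := (Cx R).
Local Notation Cn := 'rV[C]_n.
Local Notation img a := (chart_img (cm_chart (c:=X) a)).
Local Notation "w1 ~~ w2" := (eq_forms w1 w2) (at level 70).
Local Notation null := (@zero_form R n X _ _).
Local Notation scale c w := (lin_form c w null).
Lemma wirtbar_sum (U : set Cn) (I : Type) (s : seq I) (c : I -> C) (F : I -> Cn -> C) v z :
  open U -> U z -> (forall i, smooth_on U (F i)) ->
  wirtbar (fun y => \sum_(i <- s) c i * F i y) v z = \sum_(i <- s) c i * wirtbar (F i) v z.
Proof.
move=> oU Uz Fs; apply: (can_inj (@conjCK C)).
have Ss := smooth_on_sum s oU (fun i => smooth_onZ (c i) oU (Fs i)).
rewrite -(wirt_conj v Ss Uz).
have h := is_wirt_sum s (fun i => is_wirtZ (Num.conj (c i)) (is_wirt_conj v (Fs i) Uz)).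
rewrite rmorph_sum; under eq_bigr do rewrite rmorphM /=.
apply: is_wirtE; apply: (is_wirt_near oU Uz _ h) => y Uy.
by rewrite rmorph_sum; apply: eq_bigr => i _; rewrite rmorphM.
Qed.

(** The Wirtinger derivatives commute, so only signs remain: [delbar] carries (-1)^r on w but
    (-1)^(r+1) on [del w]. *)
Lemma del_delbar r s (w : local_forms X r s) : forms w ->
  del (delbar w) ~~ scale (-1) (delbar (del w)).
Proof.
move=> f a z az A B; have oa := img_open (X := X) (a := a).
rewrite /lin_form /zero_form addr0 mulN1r {2}/delbar exprS mulN1r mulNr opprK.
rewrite {1}/del mulr_sumr.
under [RHS]eq_bigr => j _.
  rewrite (wirtbar_sum (index_enum _) (fun i : 'I_r.+1 => (-1) ^+ i) (row j B) oa az
    (F := fun i => wirt (fun x => w a x (row' i A) (row' j B)) (row i A))); last first.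
    by move=> i; exact: (smooth_on_wirt _ oa (form_smooth f a _ _)).
  rewrite mulr_sumr mulr_sumr.
  over.
rewrite exchange_big /=; apply: eq_bigr => i _.
have h := is_wirtZ ((-1) ^+ r) (is_wirt_sum (index_enum _)
   (fun j : 'I_s.+1 => is_wirtZ ((-1) ^+ j) (smooth_is_wirt (row i A)
     (smooth_on_wirtbar (row j B) oa (form_smooth f a (row' i A) (row' j B))) az))).
rewrite (is_wirtE h) !mulr_sumr; apply: eq_bigr => j _.
rewrite (wirt_wirtbarC oa az (row j B) (row i A) (form_smooth f a _ _)).
by move: (wirtbar _ _ _) => d; ring.
Qed.

Lemma delbar_eq r s (w1 w2 : local_forms X r s) : forms w1 -> w1 ~~ w2 ->
  delbar w1 ~~ delbar w2.
Proof.
move=> f1 e a z az A B; have f2 := forms_eq e f1.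
have dE := del_eq (forms_conj f1) (conj_form_eq e) az B A.
apply: etrans (delbar_conj f1 az A B) (etrans _ (esym (delbar_conj f2 az A B))).
exact: (congr1 (fun x => (-1) ^+ r * Num.conj x + 0) dE).
Qed.

Lemma delbar_lin r s (c : C) (w1 w2 : local_forms X r s) : forms w1 -> forms w2 ->
  delbar (lin_form c w1 w2) ~~ lin_form c (delbar w1) (delbar w2).
Proof.
move=> f1 f2 a z az A B; have f12 := forms_lin c f1 f2.
have cE : conj_form (lin_form c w1 w2) ~~ lin_form (Num.conj c) (conj_form w1) (conj_form w2).
  by move=> a' z' _ A' B'; rewrite /conj_form /lin_form rmorphD rmorphM.
have dE := etrans (del_eq (forms_conj f12) cE az B A)
  (del_lin _ (forms_conj f1) (forms_conj f2) az B A).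
have e1 := delbar_conj f1 az A B; have e2 := delbar_conj f2 az A B.
apply: etrans (delbar_conj f12 az A B) _.
apply: etrans _ (esym (congr2 (fun x y => c * x + y) e1 e2)).
apply: etrans (congr1 (fun x => (-1) ^+ r * Num.conj x + 0) dE) _.
rewrite /lin_form /zero_form rmorphD rmorphM /= conjCK.
have alg (F : comNzRingType) (e x y d : F) :
    e * (d * x + y) + 0 = d * (e * x + 0) + (e * y + 0) by ring.
exact: alg.
Qed.

Lemma delbar_zero r s : delbar (null : local_forms X r s) ~~ null.
Proof.
have f0 := @forms_zero R n X r s.
have d0 := del_eq0 (forms_conj f0) (@conj_form_zero R n X r s).
apply: eq_forms_trans (delbar_conj f0) _; apply: scale_eq0.
exact: eq_forms_trans (conj_form_eq d0) (@conj_form_zero R n X _ _).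
Qed.

Lemma delbar_delbar r s (w : local_forms X r s) : forms w -> delbar (delbar w) ~~ null.
Proof.
move=> f; have fc := forms_conj f; have fdc := forms_del fc.
have fcdc := forms_conj fdc.
apply: eq_forms_trans (delbar_eq (forms_delbar f) (delbar_conj f)) _.
apply: eq_forms_trans (delbar_lin _ fcdc (@forms_zero R n X _ _)) _ => a z az A B.
rewrite /lin_form (@delbar_zero _ _ a z az A B) (delbar_conj fcdc az) /lin_form.
rewrite conj_formK /conj_form (del_del fc az) /zero_form.
by rewrite rmorph0 !(mulr0, addr0).
Qed.

Lemma form_null_r r s (w : local_forms X r s) : forms w -> (n < r)%N -> w ~~ null.
Proof.
move=> f nr a z az A B.
exact: (alternating_large (sigma := id) erefl (form_linA f B az) (form_altA f B az) nr A).
Qed.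

Lemma form_null_s r s (w : local_forms X r s) : forms w -> (n < s)%N -> w ~~ null.
Proof.
move=> f ns a z az A B; have c1 : (fun c : C => Num.conj c) 1 = 1 by exact: rmorph1.
exact: (alternating_large c1 (form_linB f A az) (form_altB f A az) ns B).
Qed.

(** * Exactness of closed forms *)

Section Exactness.
Variables (q : nat) (Hq : cohomologically_complete X q).

Lemma delbar_exact r s (w : local_forms X r s.+1) : (q <= s.+1)%N ->
  forms w -> delbar w ~~ null -> exists2 e : local_forms X r s, forms e & w ~~ delbar e.
Proof.
move=> qs f dw.
have Zw : @dolbeault_cocycles R n X r s.+1 w by split.
have : @dolbeault_cohomology R n X r s.+1 (coset_mod (@dolbeault_cocycles R n X r s.+1)
    (@dolbeault_coboundaries R n X r s.+1) w) by exists w.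
rewrite (Hq r qs) /= => E.
(* w lies in its own class since w - w = 0 is dbar of the zero form. That class being the zero
   class, w - 0 is a coboundary. *)
have : coset_mod (@dolbeault_cocycles R n X r s.+1)
    (@dolbeault_coboundaries R n X r s.+1) w w.
  split=> //; exists null; first exact: forms_zero.
  by move=> a z az A B; rewrite (delbar_zero az) subrr.
rewrite E => -[_ [e fe we]]; exists e => // a z az A B.
by rewrite -(we a z az A B) /zero_form subr0.
Qed.

Lemma del_exact r s (w : local_forms X r.+1 s) : (q <= r.+1)%N ->
  forms w -> del w ~~ null -> exists2 e : local_forms X r s, forms e & w ~~ del e.
Proof.
move=> qr f dw.
have [|e fe we] := @delbar_exact s r (conj_form w) qr (forms_conj f).
  move=> a z az A B; rewrite (delbar_conj (forms_conj f) az) conj_formK /lin_form.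
  by rewrite /conj_form dw // /zero_form rmorph0 mulr0 addr0.
have fce := forms_conj fe.
(* The conjugate of w is dbar e with e of type (s, r), and [delbar_conj] then produces the factor
   (-1)^s. *)
exists (scale ((-1) ^+ s) (conj_form e)); first exact: forms_scale.
move=> a z az A B; rewrite (del_scale _ fce az) /lin_form.
have := conj_form_eq we az A B; rewrite conj_formK => ->.
rewrite /conj_form (delbar_conj fe az) /lin_form /zero_form !addr0 rmorphM rmorphXn rmorphN1.
by rewrite /= /conj_form conjCK.
Qed.

(* k measures the descending induction on r, which starts above n. *)
Lemma bott_chern_exact k : forall r s (w : local_forms X r.+1 s.+1), (0 < q)%N ->
  (n < r.+1 + k)%N -> (n + q <= r.+1 + s.+1)%N ->
  forms w -> del w ~~ null -> delbar w ~~ null ->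
  exists2 e : local_forms X r s, forms e & w ~~ del (delbar e).
Proof.
elim: k => [|k IH] r s w q0 nrk nqrs f dw dbw.
(* A vanishing w has the zero form as a witness; this settles the bidegrees with a component above
   n. *)
all: have w0 : w ~~ null -> exists2 e : local_forms X r s, forms e & w ~~ del (delbar e).
1, 3: move=> w0; exists null; [exact: forms_zero|].
1, 2: apply: eq_forms_trans w0 (eq_forms_sym _).
1, 2: exact: del_eq0 (forms_delbar (@forms_zero R n X r s)) (@delbar_zero r s).
  by apply/w0/form_null_r => //; rewrite addn0 in nrk.
have [nr|rn] := ltnP n r.+1; first exact/w0/form_null_r.
have [ns|sn] := ltnP n s.+1; first exact/w0/form_null_s.
have qs : (q <= s.+1)%N by lia.
have qr : (q <= r.+1)%N by lia.
have [b fb wb] := delbar_exact qs f dbw.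
have fdb := forms_del fb.
have [b' [fb' db' wb']] : exists b' : local_forms X r.+1 s,
    [/\ forms b', del b' ~~ null & w ~~ delbar b'].
  (* If r + 1 = n in the code's indexing, [del b] has n + 1 arguments of type (1,0) and vanishes, so
     b needs no correction. *)
  have [nr2|rn2] := ltnP n r.+2.
    by exists b; split=> //; exact: form_null_r.
  case: s w dw dbw f nqrs w0 sn qs b fb wb fdb => [|s] w dw dbw f nqrs w0 sn qs b fb wb fdb.
    (* Here w would have antiholomorphic degree 1; the degree bound and q >= 1 then give n <= r + 1,
       contrary to [rn2]. *)
    by lia.
  have ddb : delbar (del b) ~~ null.
    move=> a z az A B; have := del_delbar fb az A B.
    rewrite /lin_form (del_eq (forms_delbar fb) (eq_forms_sym wb) az) dw //.
    by rewrite /zero_form addr0 mulN1r => /eqP; rewrite eq_sym oppr_eq0 => /eqP.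
  (* [del b] has holomorphic degree one higher and antiholomorphic degree one lower than w, so the
     total degree is unchanged while the distance to n drops. *)
  have [||g fg dbg] := IH _ _ (del b) q0 _ _ fdb (del_del fb) ddb; [lia|lia|].
  have fdg := forms_delbar fg.
  exists (lin_form (-1) (delbar g) b); split; first exact: forms_lin.
    move=> a z az A B; rewrite (del_lin _ fdg fb az) /lin_form -(dbg a z az A B).
    by rewrite mulN1r addNr.
  move=> a z az A B; rewrite (delbar_lin _ fdg fb az) /lin_form.
  by rewrite (delbar_delbar fg az) /zero_form mulr0 add0r wb.
have [e fe be] := del_exact qr fb' db'.
(* The sign compensates that of dbar d = - d dbar. *)
exists (scale (-1) e); first exact: forms_scale.
move=> a z az A B; rewrite wb' // (delbar_eq fb' be az).
have fde := forms_delbar fe.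
have sE : delbar (scale (-1) e) ~~ scale (-1) (delbar e).
  apply: eq_forms_trans (delbar_lin _ fe (@forms_zero R n X _ _)) _ => a' z' az' A' B'.
  by rewrite /lin_form (delbar_zero az').
rewrite (del_eq (forms_delbar (forms_scale _ fe)) sE az) (del_scale _ fde az).
rewrite /lin_form (del_delbar fe az) /lin_form /zero_form !addr0.
by rewrite !mulN1r opprK.
Qed.

End Exactness.
End BottChern.

Theorem corollary3p5 (R : realType) (n q : nat) (X : complex_manifold R n)
  (hq1 : (1 <= q)%N) (hqn : (q <= n)%N) :
  cohomologically_complete X q -> cohomologically_bott_chern_complete X q.
Proof.
move=> Hq [//|r] [//|s] _ _ nq.
set Z := @bott_chern_cocycles R n X r.+1 s.+1; set B := @bott_chern_coboundaries R n X r.+1 s.+1.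
have B0 w : Z w -> B w.
  have nr : (n < r.+1 + n)%N by lia.
  by case=> f dw dbw; exact: (bott_chern_exact Hq hq1 nr nq f dw dbw).
have Z0 : Z (@zero_form R n X _ _).
  split; first exact: forms_zero.
    exact: del_zero.
  exact: delbar_zero.
(* Classes are defined by differences, and [B0] applies to a difference once it is known to be a
   cocycle. *)
have ZB w w' : Z w -> Z w' -> Z (fun a z U V => w' a z U V - w a z U V).
  move=> [f d db] [f' d' db'].
  have E : eq_forms (lin_form (-1) w w') (fun a z U V => w' a z U V - w a z U V).
    by move=> a z _ U V; rewrite /lin_form mulN1r addrC.
  have fl := forms_lin (-1) f f'.
  split; first exact: forms_eq E fl.
  - apply: eq_forms_trans (eq_forms_sym (del_eq fl E)) _ => a z az U V.
    by rewrite (del_lin _ f f' az) /lin_form d // d' // /zero_form mulr0 addr0.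
  - apply: eq_forms_trans (eq_forms_sym (delbar_eq fl E)) _ => a z az U V.
    by rewrite (delbar_lin _ f f' az) /lin_form db // db' // /zero_form mulr0 addr0.
(* Any two cocycles differ by a coboundary, so each class is the whole of [Z] and there is a single
   class; the zero form shows that there is one. *)
have cosetE w : Z w -> coset_mod Z B w = Z.
  move=> Zw; apply/seteqP; split=> [w' []//|w' Zw']; split=> //.
  exact/B0/ZB.
apply/seteqP; split=> [K [w Zw <-]|K ->]; rewrite /= ?cosetE //.
  by rewrite /bott_chern_zero cosetE.
by exists (@zero_form R n X _ _).
Qed.
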